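(* Let $P \subseteq \mathbb{R}^d$ be a $d$-dimensional polytope with vertices in $\mathbb{Z}^d$ such that $P' := \operatorname{conv}(\operatorname{int}(P)\cap\mathbb{Z}^d) \ne \emptyset$. Then \[ \operatorname{ld}(P) \le (\operatorname{ld}(P') + 2)(s_d - 1), \] with equality if and only if $P$ is unimodularly equivalent to $S^d_k$ for some $k \in \mathbb{N}$.
   Context: The Sylvester sequence: $s_1 = 2$, $s_i = \prod_{j=1}^{i-1} s_j + 1$ for $i\ge2$. The lattice diameter $\operatorname{ld}(P)$ of a polyhedron $P$ is the maximum of $|P\cap\mathbb{Z}^d\cap g| - 1$ over all rational lines $g$ (and $\operatorname{ld}(\emptyset)=-1$). For $d\ge 2$, $k \ge 0$: $S^d_k := \operatorname{conv}(\{0, s_1e_1, \ldots, s_{d-1}e_{d-1}, (k+1)(s_d-1)e_d\})$. Unimodular equivalence: existence of an affine bijection of $\mathbb{R}^d$ preserving $\mathbb{Z}^d$ mapping one onto the other. *)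

(* Defs.v *)
From HB Require Import structures.
From mathcomp Require Import all_boot all_order all_algebra.
Set Implicit Arguments. Unset Strict Implicit. Unset Printing Implicit Defensive.
Import Order.TTheory GRing.Theory Num.Theory.
Local Open Scope ring_scope.

(* Sylvester sequence: s_1 = 2, s_i = (prod_{j=1}^{i-1} s_j) + 1.
   sylv_prod n = prod_{j=1}^{n} s_j, computed by simultaneous recursion. *)
Fixpoint sylv_prod (n : nat) : nat :=
  match n with
  | 0 => 1
  | n'.+1 => (sylv_prod n' * (sylv_prod n').+1)%N
  end.
Definition sylvester (i : nat) : nat := (sylv_prod i.-1).+1.

Section Geo.
Variables (R : realFieldType) (d : nat).

Definition intmx (z : 'rV[int]_d) : 'rV[R]_d := map_mx (fun k : int => k%:~R) z.
Definition ratmx (q : 'rV[rat]_d) : 'rV[R]_d := map_mx (fun r : rat => ratr r) q.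

Definition is_lattice (x : 'rV[R]_d) : Prop := exists z : 'rV[int]_d, x = intmx z.

Definition convex_hull (S : 'rV[R]_d -> Prop) : 'rV[R]_d -> Prop :=
  fun x => exists (n : nat) (p : 'I_n -> 'rV[R]_d) (w : 'I_n -> R),
    (forall i, S (p i)) /\ (forall i, 0 <= w i) /\
    \sum_(i < n) w i = 1 /\ x = \sum_(i < n) w i *: p i.

(* topological interior (sup-norm balls; same topology as Euclidean) *)
Definition interior (S : 'rV[R]_d -> Prop) : 'rV[R]_d -> Prop :=
  fun x => exists eps : R, 0 < eps /\
    forall y : 'rV[R]_d, (forall i, `|y 0 i - x 0 i| < eps) -> S y.

Definition polytope (V : seq 'rV[int]_d) : 'rV[R]_d -> Prop :=
  convex_hull (fun x => exists2 v, v \in V & x = intmx v).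

Definition full_dim (V : seq 'rV[int]_d) : Prop :=
  \rank (\matrix_(i < size V, j < d) (intmx (nth 0 V i) - intmx (nth 0 V 0)) 0 j)
  = d.

Definition interior_hull (P : 'rV[R]_d -> Prop) : 'rV[R]_d -> Prop :=
  convex_hull (fun x => interior P x /\ is_lattice x).

Definition on_line (a v : 'rV[rat]_d) (x : 'rV[R]_d) : Prop :=
  exists t : R, x = ratmx a + t *: ratmx v.

Definition line_count_ge (S : 'rV[R]_d -> Prop) (k : nat) : Prop :=
  exists (a v : 'rV[rat]_d), v != 0 /\
    exists pts : seq 'rV[int]_d, uniq pts /\ size pts = k /\
      forall z, z \in pts -> S (intmx z) /\ on_line a v (intmx z).

(* is_ld S n : n = ld(S) = max over rational lines g of |S ∩ Z^d ∩ g| - 1 *)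
Definition is_ld (S : 'rV[R]_d -> Prop) (n : int) : Prop :=
  (exists k : nat, line_count_ge S k /\ n + 1 = k%:Z) /\
  (forall k : nat, line_count_ge S k -> k%:Z <= n + 1).

Definition unimod_equiv (P Q : 'rV[R]_d -> Prop) : Prop :=
  exists (A : 'M[R]_d) (b : 'rV[R]_d),
    A \in unitmx /\
    (forall z : 'rV[int]_d, exists z' : 'rV[int]_d, intmx z *m A + b = intmx z') /\
    (forall z' : 'rV[int]_d, exists z : 'rV[int]_d, intmx z *m A + b = intmx z') /\
    (forall y, Q y <-> exists x, P x /\ x *m A + b = y).

End Geo.

(* vertex list of S^d_k = conv{0, s_1 e_1, ..., s_{d-1} e_{d-1}, (k+1)(s_d - 1) e_d};
   index i : 'I_d (0-based) stands for e_{i+1}. *)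
Definition simplex_verts (d k : nat) : seq 'rV[int]_d :=
  0 :: [seq (if ((nat_of_ord i).+1 < d)%N then Posz (sylvester i.+1)
             else Posz (k.+1 * (sylvester d).-1)%N) *: delta_mx (0 : 'I_1) i
       | i : 'I_d <- enum 'I_d].

(* Main.v *)
Require Import Defs.
From HB Require Import structures.
From mathcomp Require Import all_boot all_order all_algebra.
From mathcomp Require Import ring lra zify.
From Stdlib Require Import Classical.
Import Order.TTheory GRing.Theory Num.Theory.
Set Implicit Arguments.
Unset Strict Implicit.
Unset Printing Implicit Defensive.
Local Open Scope ring_scope.

(* Let [p, p + n w] be a longest lattice segment of P, with w primitive, and
   project P along w. If y is a lattice point interior to the projection Q and
   y = l p + (1 - l) q with q in Q, the fibre over y has length at least l n by
   convexity, while its interior lattice points bound that length by ld(P') + 2.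
   So it is enough to find y with l >= 1 / (s_1 ... s_(d-1)) = 1 / (s_d - 1).

   Take y with l maximal and, by Caratheodory, write it on an affinely
   independent set of p and r <= d - 1 vertices, with coefficients l and
   b_1 >= ... >= b_r. A pigeonhole (Minkowski) argument shows that
   b_1 ... b_j > 1 - b_1 - ... - b_j would produce a lattice point with larger l,
   and the opposite inequalities for all j force l >= 1 / (s_1 ... s_r), with
   equality only for b_i = 1 / s_i.

   In the equality case the s_i being pairwise coprime makes (v_i - p) / s_i a
   lattice vector W_i; maximality of l makes W_1, ..., W_(d-1), w a lattice basis
   and, by perturbing y towards a vertex, excludes vertices outside the simplex. *)

(** * Sylvester's sequence and the pigeonhole lemma *)

(** The numbers 1/s_i are extremal because they turn every inequality b_1 ... b_j <= 1 - b_1 - ... -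
    b_j into an equality, both sides being 1 / (s_1 ... s_j). The inequalities constrain prefixes
    only, so b_i cannot be compared with 1/s_i term by term, and the ordering of the b_i is
    essential.

    The pigeonhole step must stay over the interior of Q. A lattice point whose coefficients are
    positive wherever those of y are, and also positive at p, lies again over the interior; the
    strict bounds in the pigeonhole lemma secure this positivity.

    The field R is assumed neither complete nor Archimedean. Extrema therefore come from finiteness
    (lattice points modulo w, and supports), integer parts from explicit bounds or from rational
    coordinates. The projection itself is never formed: points are handled up to real multiples of
    w, and primitivity of w is witnessed by a column u with w u = 1, which reads off coordinates
    along w. *)

Lemma sylv_prod_gt0 n : (0 < sylv_prod n)%N.
Proof. by elim: n => //= n IH; rewrite muln_gt0 IH. Qed.

Lemma sylv_prod_ltn r m : (r < m)%N -> (sylv_prod r < sylv_prod m)%N.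
Proof.
elim: m => // m IH; rewrite ltnS leq_eqVlt => /orP[/eqP->|/IH lt_rm] /=.
  by have := sylv_prod_gt0 m; nia.
by have := sylv_prod_gt0 m; nia.
Qed.

(** If i < j, then s_(i+1) is a factor of [sylv_prod j], so s_(j+1) is 1 modulo s_(i+1). *)
Lemma sylv_coprime i j : i != j ->
  coprime (sylv_prod i).+1 (sylv_prod j).+1.
Proof.
wlog lt_ij : i j / (i < j)%N.
  move=> H; case: (ltngtP i j) => [lt_ij _|lt_ji _|//].
    by apply: H; rewrite ?ltn_eqF.
  by rewrite coprime_sym; apply: H; rewrite ?ltn_eqF.
move=> _; have : ((sylv_prod i).+1 %| sylv_prod j)%N.
  elim: j lt_ij => // j IH; rewrite ltnS leq_eqVlt => /orP[/eqP->|/IH H] /=.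
    exact: dvdn_mull.
  exact: dvdn_mulr.
move=> /dvdnP[k ->].
by rewrite /coprime -[(k * _).+1]addn1 gcdnMDl gcdn1.
Qed.

Section SylvesterBound.
Variable R : realFieldType.
Implicit Types x y : nat -> R.

(** Indices start at 0: this is 1 / s_(i+1). *)
Definition sylv_unit (i : nat) : R := ((sylv_prod i).+1)%:R^-1.

Lemma sylv_unit_gt0 i : 0 < sylv_unit i.
Proof. by rewrite invr_gt0 ltr0n. Qed.

(** Telescoping: 1/(a + 1) = 1/a - 1/(a (a + 1)) with a = [sylv_prod r]. *)
Lemma sum_sylv_unit r : \sum_(i < r) sylv_unit i = 1 - (sylv_prod r)%:R^-1.
Proof.
elim: r => [|r IH]; first by rewrite big_ord0 invr1 subrr.
rewrite big_ord_recr /= IH /sylv_unit natrM -natr1.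
have : 0 < (sylv_prod r)%:R :> R by rewrite ltr0n sylv_prod_gt0.
move: (_%:R) => a a0; field.
by rewrite !gt_eqF // ltr_wpDl // ltW.
Qed.

Lemma prod_sylv_unit r : \prod_(i < r) sylv_unit i = (sylv_prod r)%:R^-1.
Proof.
elim: r => [|r IH]; first by rewrite big_ord0 invr1.
by rewrite big_ord_recr /= IH /sylv_unit -invfM -natrM mulnC.
Qed.

(** AM-GM with its equality case: a mean equal to 1 leaves no room for a product of at least 1, so
    all factors coincide. *)
Lemma sum_ge_of_prod_ge1 n x : (forall i, (i < n)%N -> 0 < x i) ->
  1 <= \prod_(i < n) x i ->
  n%:R <= \sum_(i < n) x i /\
  (\sum_(i < n) x i = n%:R -> forall i, (i < n)%N -> x i = 1).
Proof.
case: n => [|n] x0 xp; first by rewrite big_ord0; split.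
have pos : {in 'I_n.+1, forall i : 'I_n.+1, 0 <= x i}.
  by move=> i _; rewrite ltW ?x0.
have := leif_AGM pos; rewrite card_ord.
set S := \sum_(i in _) _; set p := \prod_(i in _) _ => -[le_p eq_p].
have S0 : 0 <= S by apply: sumr_ge0 => i _; apply: pos.
have n0 : 0 < n.+1%:R :> R by rewrite ltr0n.
have p1 : 1 <= p by [].
have le1 : 1 <= S / n.+1%:R.
  rewrite -(@expr_ge1 _ n.+1) ?divr_ge0 ?(ltW n0) //.
  exact: le_trans le_p.
split; first by rewrite ler_pdivlMr ?mul1r in le1.
move=> SE i lt_in.
have SE' : S = n.+1%:R by [].
have : p == (S / n.+1%:R) ^+ n.+1.
  by rewrite eq_le le_p SE' divff ?expr1n // gt_eqF.
rewrite eq_p => /forallP H.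
have xE j : (j < n.+1)%N -> x j = x i.
  move=> lt_jn; have /implyP/(_ isT)/forallP/(_ (Ordinal lt_in)) := H (Ordinal lt_jn).
  by move/implyP/(_ isT)/eqP.
have : S = n.+1%:R * x i.
  rewrite /S (eq_bigr (fun=> x i)); last by move=> j _; apply: xE.
  by rewrite sumr_const card_ord mulr_natl.
rewrite SE' -[LHS]mulr1 => /mulfI; rewrite gt_eqF // => /(_ isT); done.
Qed.

(* Abel summation against the decreasing sequence x reduces the claim to AM-GM
   for the partial products of y / x. *)
Lemma sum_le_of_prod_le n x y :
  (forall i, (i < n)%N -> 0 < x i) -> (forall i, (i < n)%N -> 0 < y i) ->
  (forall i j, (i <= j < n)%N -> x j <= x i) ->
  (forall l, (l <= n)%N -> \prod_(i < l) x i <= \prod_(i < l) y i) ->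
  \sum_(i < n) x i <= \sum_(i < n) y i /\
  (\sum_(i < n) x i = \sum_(i < n) y i -> forall i, (i < n)%N -> x i = y i).
Proof.
move=> x0 y0 xdec le_prod; pose z i := y i / x i.
have z0 i : (i < n)%N -> 0 < z i by move=> lt_in; rewrite divr_gt0 ?x0 ?y0.
have prodz l : (l <= n)%N -> 1 <= \prod_(i < l) z i.
  move=> le_ln; rewrite big_split /= prodfV ler_pdivlMr ?mul1r ?le_prod //.
  by apply: prodr_gt0 => i _; rewrite x0 // (leq_trans (ltn_ord i)).
pose D l := \sum_(i < l) z i - l%:R.
have D_ge0 l : (l <= n)%N -> 0 <= D l.
  move=> le_ln; rewrite subr_ge0.
  have zl i : (i < l)%N -> 0 < z i by move=> lt_il; rewrite z0 // (leq_trans lt_il).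
  by case: (sum_ge_of_prod_ge1 zl (prodz l le_ln)).
have DS l : D l.+1 = D l + (z l - 1).
  by rewrite /D big_ord_recr /= -natr1; ring.
have abel l : (l < n)%N -> x l * D l.+1 <= \sum_(i < l.+1) (y i - x i).
  have yxE k : (k < n)%N -> y k - x k = x k * (z k - 1).
    by move=> lt_kn; rewrite /z; field; rewrite gt_eqF ?x0.
  elim: l => [|l IH] lt_ln.
    by rewrite big_ord_recr big_ord0 /= add0r DS /D big_ord0 subr0 add0r yxE.
  rewrite big_ord_recr /= yxE //.
  have lt_l : (l < n)%N by exact: ltnW.
  apply: le_trans (lerD (IH lt_l) (lexx _)).
  rewrite DS mulrDr lerD2r; apply: ler_wpM2r; first exact: D_ge0.
  by apply: xdec; rewrite leqnSn.
case: n => [|n] in x0 y0 xdec le_prod z0 prodz D_ge0 abel *.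
  by rewrite !big_ord0; split.
have := abel n (ltnSn n); rewrite sumrB => absum.
have xD : 0 <= x n * D n.+1 by rewrite mulr_ge0 ?D_ge0 // ltW ?x0.
split; first by rewrite -subr_ge0; apply: le_trans absum.
(* Equal sums squeeze [x n * D n.+1] to 0, so the ratios z sum to their number and are all 1. *)
move=> eq_s i lt_in; rewrite eq_s subrr in absum.
have : x n * D n.+1 == 0 by rewrite eq_le xD absum.
rewrite mulf_eq0 gt_eqF ?x0 //= subr_eq0 => /eqP sz.
have [_ /(_ sz i lt_in)] := sum_ge_of_prod_ge1 z0 (prodz _ (leqnn _)).
by rewrite /z => /divr1_eq.
Qed.

(** Suppose the sum of x reaches that of the units. Then the full product of x is at most that of
    the units, and the last index k whose tail product is still dominated cuts the range in two: the
    tail from k falls under [sum_le_of_prod_le], the head under the induction hypothesis. *)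
Lemma sylvester_sum_le r x :
  (forall i, (i < r)%N -> 0 < x i) ->
  (forall i j, (i <= j < r)%N -> x j <= x i) ->
  (forall l, (l <= r)%N -> \prod_(i < l) x i <= 1 - \sum_(i < l) x i) ->
  \sum_(i < r) x i <= \sum_(i < r) sylv_unit i /\
  (\sum_(i < r) x i = \sum_(i < r) sylv_unit i ->
   forall i, (i < r)%N -> x i = sylv_unit i).
Proof.
elim/ltn_ind: r => -[|r] IH x0 xdec ps; first by rewrite !big_ord0; split.
have [lt_s|ge_s] := ltP (\sum_(i < r.+1) x i) (\sum_(i < r.+1) sylv_unit i).
  by split; [exact: ltW | move=> E; rewrite E ltxx in lt_s].
pose Q k := (k <= r)%N &&
  (\prod_(k <= i < r.+1) x i <= \prod_(k <= i < r.+1) sylv_unit i).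
have Q0 : exists k, Q k.
  exists 0%N; rewrite /Q /= !big_mkord prod_sylv_unit.
  apply: le_trans (ps _ (leqnn _)) _.
  by move: ge_s; rewrite sum_sylv_unit; lra.
have Qb k : Q k -> (k <= r)%N by case/andP.
case: (ex_maxnP Q0 Qb) => k /andP[le_kr Qk] maxk.
have px a b : (b <= r.+1)%N -> 0 < \prod_(a <= i < b) x i.
  move=> le_br; rewrite big_nat prodr_gt0 // => i /andP[_ lt_ib].
  by rewrite x0 // (leq_trans lt_ib).
have pu a b : 0 < \prod_(a <= i < b) sylv_unit i.
  by rewrite prodr_gt0 // => i _; rewrite sylv_unit_gt0.
(* Maximality of k makes [Q l] fail. If the product from k to l also exceeded that of the units,
   multiplying the two would contradict [Q k]. *)
have tail l : (k <= l <= r.+1)%N ->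
    \prod_(k <= i < l) x i <= \prod_(k <= i < l) sylv_unit i.
  case/andP=> le_kl; rewrite leq_eqVlt => /orP[/eqP->//|lt_lr].
  case: (ltngtP k l) le_kl => // [lt_kl _|->]; last by rewrite !big_geq.
  have nQ : ~~ Q l by apply/negP => /maxk; rewrite leqNgt lt_kl.
  rewrite /Q -ltnS lt_lr /= -ltNge in nQ.
  rewrite leNgt; apply/negP => lt_p.
  have : \prod_(k <= i < r.+1) sylv_unit i < \prod_(k <= i < r.+1) x i.
    rewrite (big_cat_nat (ltnW lt_kl) (ltnW lt_lr)) /=.
    rewrite [X in _ < X](big_cat_nat (ltnW lt_kl) (ltnW lt_lr)) /=.
    by apply: ltr_pM => //; rewrite ltW.
  by rewrite ltNge Qk.
have shift (f : nat -> R) l : \sum_(k <= i < k + l) f i = \sum_(i < l) f (i + k)%N.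
  by rewrite -{1}[k]add0n big_addn addKn big_mkord.
have shiftp (f : nat -> R) l : \prod_(k <= i < k + l) f i = \prod_(i < l) f (i + k)%N.
  by rewrite -{1}[k]add0n big_addn addKn big_mkord.
have kr : (k + (r.+1 - k) = r.+1)%N by rewrite subnKC // ltnW.
have [||||s2 e2] := @sum_le_of_prod_le (r.+1 - k) (fun i => x (i + k)%N)
                   (fun i => sylv_unit (i + k)).
- by move=> i lt_i; apply: x0; lia.
- by move=> i _; apply: sylv_unit_gt0.
- by move=> i j lt_ij; apply: xdec; lia.
- by move=> l le_l; rewrite -!shiftp; apply: tail; lia.
have [s1 e1] : \sum_(i < k) x i <= \sum_(i < k) sylv_unit i /\
  (\sum_(i < k) x i = \sum_(i < k) sylv_unit i ->
   forall i, (i < k)%N -> x i = sylv_unit i).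
  apply: IH => [|i lt_ik|i j lt_ij|l le_l]; first by rewrite ltnS.
  - by apply: x0; lia.
  - by apply: xdec; lia.
  - by apply: ps; lia.
have splits (f : nat -> R) : \sum_(i < r.+1) f i =
   \sum_(i < k) f i + \sum_(i < r.+1 - k) f (i + k)%N.
  rewrite -shift kr -(big_mkord xpredT f) -(big_mkord xpredT f).
  by rewrite -big_cat_nat // ltnW.
rewrite !splits; split; first exact: lerD.
move=> E i lt_ir.
have [E1 E2] : \sum_(i < k) x i = \sum_(i < k) sylv_unit i /\
  \sum_(i < r.+1 - k) x (i + k)%N = \sum_(i < r.+1 - k) sylv_unit (i + k).
  by split; lra.
case: (ltnP i k) => [lt_ik|le_ki]; first exact: e1.
have := e2 E2 (i - k)%N; rewrite subnK //; apply; lia.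
Qed.

End SylvesterBound.

(* The vectors [b i * t - q * n i] with [\sum_i n i = t] form a lattice of index
   [e * q ^ m] in [Z ^ (m + 1)], so two points of the box with sides [b i] are
   congruent modulo it. *)
Lemma box_pigeonhole m (b : 'I_m.+1 -> nat) (q e : nat) :
  (\sum_i b i + e = q)%N -> (0 < e)%N ->
  (e * q ^ m < \prod_i b i)%N ->
  exists (t : nat) (n : 'I_m.+1 -> int),
    [/\ (0 < t)%N, \sum_i n i = t%:Z &
        forall i, `|(b i * t)%N%:Z - q%:Z * n i| < (b i)%:Z].
Proof.
move=> qE e0 lt_e.
have b0 i : (0 < b i)%N.
  rewrite lt0n; apply: contraL lt_e => /eqP bi0.
  by rewrite (bigD1 i) //= bi0.
have bq i : (b i < q)%N by rewrite -qE (bigD1 i) //=; lia.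
have q0 : (0 < q)%N by exact: leq_ltn_trans (bq ord0).
pose D := {dffun forall i : 'I_m.+1, 'I_(b i)}.
pose C := ('I_e * {ffun 'I_m -> 'I_q})%type.
pose S (a : D) := (\sum_i (a i : nat))%N.
(* The class of a modulo the lattice. A lattice vector b t - q n has coordinate sum - e t, so t is
   read off from [S], and the residues mod q detect the remaining condition. Coordinate 0 is
   omitted: its congruence follows from the others, the total being a multiple of q by [sumg]. *)
pose f (a : D) : C := (Ordinal (ltn_pmod (S a) e0),
  [ffun j => Ordinal (ltn_pmod (b (lift ord0 j) * (S a %/ e) + a (lift ord0 j)) q0)]).
have cardD : #|{: D}| = (\prod_i b i)%N.
  rewrite card_dep_ffun foldrE big_image.
  by apply: eq_bigr => i _; rewrite card_ord.
have cardC : #|{: C}| = (e * q ^ m)%N by rewrite card_prod card_ffun !card_ord.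
have : ~~ injectiveb f.
  apply/negP => /injectiveP/leq_card; rewrite cardD cardC.
  by rewrite leqNgt lt_e.
move=> /injectivePn[a [a' neq_a /eqP]]; rewrite xpair_eqE => /andP[/eqP E1 /eqP E2].
wlog le_S : a a' neq_a E1 E2 / (S a %/ e <= S a' %/ e)%N.
  move=> H; case/orP: (leq_total (S a %/ e) (S a' %/ e)) => le_S.
    exact: (H a a').
  by apply: (H a' a); rewrite // eq_sym.
have {}E1 : (S a %% e = S a' %% e)%N by case: E1.
have {}E2 j : (b (lift ord0 j) * (S a %/ e) + a (lift ord0 j) =
               b (lift ord0 j) * (S a' %/ e) + a' (lift ord0 j) %[mod q])%N.
  by move/ffunP/(_ j): E2; rewrite !ffunE => -[].
set T := (S a %/ e)%N in E2 le_S; set T' := (S a' %/ e)%N in E2 le_S.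
pose t := (T' - T)%N.
have SE : (S a' = S a + e * t)%N.
  rewrite (divn_eq (S a') e) (divn_eq (S a) e) E1 -/T -/T' /t mulnBr.
  by have := leq_mul (leqnn e) le_S; lia.
pose g i : int := (b i * t)%N%:Z - ((a i)%:Z - (a' i)%:Z).
have sumg : \sum_i g i = q%:Z * t%:Z.
  have sz (F : 'I_m.+1 -> nat) : \sum_i (F i)%:Z = (\sum_i F i)%N%:Z.
    by rewrite -(big_morph Posz PoszD (erefl _)).
  rewrite /g !sumrB !sz -/(S a) -/(S a') SE -qE -big_distrl /=.
  by rewrite !PoszM !PoszD !PoszM; ring.
have gl j : (q%:Z %| g (lift ord0 j))%Z.
  have -> : g (lift ord0 j) = - ((b (lift ord0 j) * T + a (lift ord0 j))%N%:Z -
        (b (lift ord0 j) * T' + a' (lift ord0 j))%N%:Z).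
    rewrite /g /t; have := leq_mul (leqnn (b (lift ord0 j))) le_S.
    by rewrite mulnBr; lia.
  by rewrite rpredN -eqz_mod_dvd !modz_nat E2.
have gd i : (q%:Z %| g i)%Z.
  case: (unliftP ord0 i) => [j ->|->]; first exact: gl.
  have : g ord0 = q%:Z * t%:Z - \sum_(j < m) g (lift ord0 j).
    by rewrite -sumg big_ord_recl addrK.
  move=> ->; rewrite rpredB ?dvdz_mulr ?rpred_sum //.
exists t, (fun i => (g i %/ q)%Z).
have nE i : q%:Z * (g i %/ q)%Z = g i by rewrite mulrC divzK.
have small i : `|(a i)%:Z - (a' i)%:Z| < (b i)%:Z.
  by have := ltn_ord (a i); have := ltn_ord (a' i); lia.
split.
(* If t = 0, the coordinate differences are multiples of q smaller than [b i] < q, so a = a'. *)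
- rewrite lt0n; apply/negP => /eqP t0; move/eqP: neq_a; apply.
  apply/ffunP => i; apply: val_inj => /=.
  have := gd i; rewrite /g t0 muln0 sub0r dvdzE abszN.
  have lt_q : (`|(a i)%:Z - (a' i)%:Z| < q)%N.
    by have := small i; have := bq i; lia.
  by rewrite /dvdn modn_small // absz_eq0 subr_eq0 => /eqP[].
- apply: (@mulfI _ q%:Z); first by lia.
  by rewrite mulr_sumr (eq_bigr g) // => i _; rewrite nE.
- by move=> i; rewrite nE /g opprB addrC subrK.
Qed.

(** * Lattice polytopes *)

Lemma int_seq_min (s : seq int) : s != [::] ->
  exists2 m, m \in s & forall x, x \in s -> m <= x.
Proof.
elim: s => // a [|b s] IH _.
  by exists a; rewrite ?mem_seq1 // => x; rewrite mem_seq1 => /eqP->.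
have [//|m m_s le_m] := IH.
case/orP: (le_total a m) => le_am.
  exists a; first by rewrite mem_head.
  by move=> x; rewrite in_cons => /orP[/eqP->//|/le_m]; apply: le_trans.
exists m; first by rewrite in_cons m_s orbT.
by move=> x; rewrite in_cons => /orP[/eqP->//|/le_m].
Qed.

Lemma uniq_int_spread (s : seq int) : uniq s -> (0 < size s)%N ->
  exists a b, [/\ a \in s, b \in s & (size s)%:Z <= b - a + 1].
Proof.
move=> us s0; have sn : s != [::] by case: s s0 {us}.
have [a a_s le_a] := int_seq_min sn.
have sn' : [seq - x | x <- s] != [::] by case: s s0 {us sn a_s le_a}.
have [b' /mapP[b b_s ->] le_b] := int_seq_min sn'.
have {}le_b x : x \in s -> x <= b.
  by move=> xs; rewrite -lerN2 le_b // map_f.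
exists a, b; split=> //.
have inj : {in s &, injective (fun x => `|x - a|%N)}.
  by move=> x y xs ys; have := le_a _ xs; have := le_a _ ys; lia.
rewrite -(map_inj_in_uniq inj) in us.
have := @uniq_leq_size _ _ (iota 0 (`|b - a|%N).+1) us.
rewrite size_map size_iota => /(_ _) H.
have : (size s <= (`|b - a|).+1)%N.
  apply: H => _ /mapP[x xs ->]; rewrite mem_iota.
  by have := le_a _ xs; have := le_b _ xs; lia.
by have := le_a _ b_s; lia.
Qed.

(** The Smith normal form writes D as a multiple of the first row w of a unimodular matrix; u is the
    first column of the inverse. *)
Lemma primitive_vector d (D : 'rV[int]_d) : D != 0 ->
  exists (w : 'rV[int]_d) (u : 'cV[int]_d) (g : int), D = g *: w /\ w *m u = 1%:M.
Proof.
case: d D => [|d] D; first by rewrite thinmx0 eqxx.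
have [L _ [Q Qu [s _ ->]]] := int_Smith_normal_form D.
exists (row ord0 Q), (col ord0 (invmx Q)), (L 0 0 * s`_0); split.
  apply/rowP => j; rewrite !mxE (bigD1 ord0) //= big1 ?addr0 => [|k /negPf k0].
    by rewrite !mxE big_ord1 !mxE eqxx mulr1n.
  rewrite !mxE big_ord1 !mxE.
  by rewrite -(inj_eq val_inj) eq_sym in k0; rewrite k0 mulr0n mulr0 mul0r.
apply/matrixP=> i j; rewrite !ord1; have /matrixP/(_ ord0 ord0) := mulmxV Qu.
by rewrite !mxE /= => <-; apply: eq_bigr => k _; rewrite !mxE.
Qed.

(** Without the Archimedean property, an integer part needs an explicit bound by a natural
    number. *)
Lemma exists_int_floor (R : realFieldType) (x : R) (B : nat) : `|x| <= B%:R ->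
  exists c : int, c%:~R <= x < (c + 1)%:~R.
Proof.
have H k (y : R) : 0 <= y < k%:R -> exists c : int, c%:~R <= y < (c + 1)%:~R.
  elim: k => [|k IH] /andP[y0 yk]; first by case/negP: (le_gtF y0); rewrite yk.
  case: (ltP y k%:R) => [lt_yk|le_ky]; first by apply: IH; rewrite y0.
  by exists k%:Z; rewrite le_ky /= -[k%:Z + 1]/((k + 1)%N%:Z) addn1.
move=> xB; have [|c] := H (2 * B).+1%N (x + B%:R).
  by move: xB; rewrite ler_norml -natr1 natrM => /andP[? ?]; apply/andP; split; lra.
move=> /andP[c1 c2]; exists (c - B%:Z); move: c1 c2.
by rewrite !rmorphD /= !rmorphN /= rmorph1; move: (c%:~R : R) => a ? ?; apply/andP; split; lra.
Qed.

Section Geometry.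
Variables (R : realFieldType) (d : nat).
Local Notation X := (@intmx R d).
Implicit Types (x y : 'rV[R]_d) (z p w : 'rV[int]_d) (S : 'rV[R]_d -> Prop).

Lemma intmx0 : X 0 = 0.
Proof. by apply/rowP => j; rewrite !mxE. Qed.

Lemma intmxD z p : X (z + p) = X z + X p.
Proof. by apply/rowP => j; rewrite !mxE rmorphD. Qed.

Lemma intmxB z p : X (z - p) = X z - X p.
Proof. by apply/rowP => j; rewrite !mxE rmorphB. Qed.

Lemma intmxZ (c : int) z : X (c *: z) = c%:~R *: X z.
Proof. by apply/rowP => j; rewrite !mxE rmorphM. Qed.

Lemma intmx_sum (I : finType) (F : I -> 'rV[int]_d) :
  X (\sum_i F i) = \sum_i X (F i).
Proof. by rewrite (big_morph X intmxD intmx0). Qed.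

Lemma intmx_inj : injective X.
Proof.
move=> z p /rowP E; apply/rowP => j; move: (E j); rewrite !mxE.
exact: intr_inj.
Qed.

Lemma intmx_mul n (z : 'rV[int]_d) (u : 'M[int]_(d, n)) j :
  (X z *m map_mx intr u) 0 j = ((z *m u) 0 j)%:~R.
Proof.
by rewrite !mxE rmorph_sum; apply: eq_bigr => i _; rewrite !mxE -rmorphM.
Qed.

Lemma intmx_delta (i : 'I_d) : X (delta_mx 0 i) = delta_mx 0 i.
Proof. by apply/rowP => j; rewrite !mxE; case: andb. Qed.

Lemma int_box (B : nat) : exists s : seq 'rV[int]_d,
  forall z, (forall i, `|z 0 i| <= B%:Z) -> z \in s.
Proof.
exists [seq \row_i ((f i : nat)%:Z - B%:Z) | f : {ffun 'I_d -> 'I_(2 * B).+1}].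
move=> z zB; apply/imageP; exists [ffun i => inord `|(z 0%R i + B%:Z)%R|%N] => //.
by apply/rowP => i; rewrite !mxE ffunE inordK; have := zB i; move: (z 0 i) => a; lia.
Qed.

Lemma interior_sub S x : interior S x -> S x.
Proof. by move=> [e [e0 H]]; apply: H => i; rewrite subrr normr0. Qed.

Lemma interior_shift S x (y : 'rV[R]_d) : interior S x ->
  exists2 e : R, 0 < e & S (x + e *: y).
Proof.
move=> [e [e0 H]]; pose M := 1 + \sum_i `|y 0 i|.
have M0 : 0 < M by rewrite ltr_pwDl ?sumr_ge0.
exists (e / M); first by rewrite divr_gt0.
apply: H => i; rewrite !mxE addrAC subrr add0r normrM (gtr0_norm (divr_gt0 e0 M0)).
rewrite mulrAC ltr_pdivrMr // ltr_pM2l // /M (bigD1 i) //= addrCA.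
by rewrite ltrDl ltr_pwDl ?sumr_ge0.
Qed.

Definition convex2 S := forall x y (t : R), 0 <= t -> t <= 1 ->
  S x -> S y -> S (t *: x + (1 - t) *: y).

Lemma interior_mix S x y t : convex2 S -> 0 < t -> t <= 1 ->
  interior S x -> S y -> interior S (t *: x + (1 - t) *: y).
Proof.
move=> cS t0 t1 [e [e0 H]] Sy; exists (e * t); split; first exact: mulr_gt0.
move=> y' near.
have -> : y' = t *: (t^-1 *: (y' - (1 - t) *: y)) + (1 - t) *: y.
  by rewrite scalerA divff ?gt_eqF // scale1r subrK.
apply: cS => //; first exact: ltW.
apply: H => i; have := near i; rewrite !mxE.
have -> : t^-1 * (y' 0 i - (1 - t) * y 0 i) - x 0 i =
  (y' 0 i - (t * x 0 i + (1 - t) * y 0 i)) / t.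
  by field; rewrite gt_eqF.
by rewrite normrM normfV (gtr0_norm t0) ltr_pdivrMr.
Qed.

Lemma convex_hull_sub S x : S x -> convex_hull S x.
Proof.
move=> Sx; exists 1%N, (fun=> x), (fun=> 1); split=> //; split=> //.
by rewrite !big_ord1 scale1r.
Qed.

Lemma convex_hull_convex2 S : convex2 (convex_hull S).
Proof.
move=> x y t t0 t1 [n [p [a [Sp [a0 [a1 ->]]]]]] [m [q [b [Sq [b0 [b1 ->]]]]]].
exists (n + m)%N, (fun i => match split i with inl j => p j | inr j => q j end),
  (fun i => match split i with inl j => t * a j | inr j => (1 - t) * b j end).
have sl j : split (lshift m j) = inl j by exact: (unsplitK (inl j)).
have sr j : split (rshift n j) = inr j by exact: (unsplitK (inr j)).
split; [|split; [|split]].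
- by move=> i; case: (split i).
- by move=> i; case: (split i) => j; rewrite mulr_ge0 // subr_ge0.
- rewrite big_split_ord /=.
  under eq_bigr do rewrite sl; under [X in _ + X]eq_bigr do rewrite sr.
  by rewrite -!mulr_sumr a1 b1 !mulr1 addrC subrK.
- rewrite big_split_ord /= !scaler_sumr; congr (_ + _); apply: eq_bigr => j _.
    by rewrite sl scalerA.
  by rewrite sr scalerA.
Qed.

Lemma progression_line_count S p w K : w != 0 ->
  (forall j : nat, (j < K)%N -> S (X (p + j%:Z *: w))) -> line_count_ge S K.
Proof.
move=> w0 H; pose iq (z : 'rV[int]_d) : 'rV[rat]_d := map_mx intr z.
have ratE z : ratmx R (iq z) = X z.
  by apply/rowP => j; rewrite !mxE ratr_int.
have [k wk] : exists k, w 0 k != 0.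
  apply/existsP; apply: contraNT w0 => /existsPn E; apply/eqP/rowP => k.
  by rewrite mxE; apply/eqP; move: (E k); rewrite negbK.
exists (iq p), (iq w); split.
  apply: contraNneq wk => /rowP/(_ k); rewrite !mxE => /eqP.
  by rewrite intr_eq0.
exists [seq p + j%:Z *: w | j <- iota 0 K]; split; [|split].
- rewrite map_inj_uniq ?iota_uniq // => i j /addrI/rowP/(_ k).
  by rewrite !mxE => /(mulIf wk)[].
- by rewrite size_map size_iota.
- move=> z /mapP[j]; rewrite mem_iota => /andP[_ lt_jK] ->; split; first exact: H.
  by exists j%:R; rewrite !ratE intmxD intmxZ.
Qed.

(** The K points need not be consecutive on their line, but two of them are at least K - 1 steps of
    a primitive w apart, and convexity fills in the lattice points between them. *)
Lemma line_count_progression S K : convex2 S -> (1 < K)%N -> line_count_ge S K ->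
  exists p w (u : 'cV[int]_d), w *m u = 1%:M /\
  forall j : nat, (j < K)%N -> S (X (p + j%:Z *: w)).
Proof.
move=> cS K1 [a [v [_ [pts [upts [szp H]]]]]].
pose z0 := nth 0 pts 0; pose z1 := nth 0 pts 1.
have z0p : z0 \in pts by rewrite mem_nth // szp ltnW.
have z1p : z1 \in pts by rewrite mem_nth // szp.
have D0 : z1 - z0 != 0.
  by rewrite subr_eq0 nth_uniq // szp // ltnW.
have [w [u [g [DE wu]]]] := primitive_vector D0.
have line z : z \in pts -> exists t, X z = X z0 + t *: X w.
  move=> zp; have [_ [t tE]] := H _ zp; have [_ [t0 t0E]] := H _ z0p.
  have [_ [t1 t1E]] := H _ z1p.
  have t10 : t1 - t0 != 0.
    rewrite subr_eq0; apply: contraNneq D0 => E.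
    by rewrite subr_eq0; apply/eqP/intmx_inj; rewrite t1E t0E E.
  have vE : (t1 - t0) *: ratmx R v = g%:~R *: X w.
    by rewrite -intmxZ -DE intmxB t1E t0E scalerBl opprD addrACA subrr add0r.
  exists ((t - t0) / (t1 - t0) * g%:~R).
  rewrite -scalerA -vE scalerA divfK // tE t0E scalerBl -!addrA; congr (_ + _).
  by rewrite addrCA subrr addr0.
pose c z := ((z - z0) *m u) 0 0.
have cE z : z \in pts -> z = z0 + c z *: w.
  move=> /line[t tE]; apply: intmx_inj; rewrite tE intmxD intmxZ; congr (_ + _ *: _).
  rewrite /c -intmx_mul intmxB tE addrAC subrr add0r -scalemxAl mxE.
  by rewrite intmx_mul wu !mxE eqxx mulr1.
have cinj : {in pts &, injective c}.
  by move=> z z' zp zp' E; rewrite (cE _ zp) (cE _ zp') E.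
have [||c1 [c2 []]] := @uniq_int_spread [seq c z | z <- pts].
- by rewrite map_inj_in_uniq.
- by rewrite size_map szp ltnW.
move=> /mapP[y1 y1p ->] /mapP[y2 y2p ->]; rewrite size_map szp => le_K.
exists y1, w, u; split=> // j lt_jK.
set l := c y2 - c y1 in le_K.
have l0 : 0 < l by lia.
have lR : 0 < l%:~R :> R by rewrite ltr0z.
have y2E : y2 = y1 + l *: w.
  rewrite (cE _ y2p) [in RHS](cE _ y1p) /l scalerBl -!addrA; congr (_ + _).
  by rewrite addrCA subrr addr0.
pose t : R := j%:R / l%:~R.
have -> : X (y1 + j%:Z *: w) = t *: X y2 + (1 - t) *: X y1.
  rewrite y2E !intmxD !intmxZ /t; apply/rowP => k; rewrite !mxE -[j%:~R]/(j%:R).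
  by field; rewrite gt_eqF.
apply: cS; [by rewrite divr_ge0 ?ler0n ?ltW| |by case: (H _ y2p)|by case: (H _ y1p)].
rewrite ler_pdivrMr // mul1r -[j%:R]/(j%:Z%:~R) ler_int; lia.
Qed.

Lemma is_ld_exists S (s : seq 'rV[int]_d) : (0 < d)%N ->
  (forall z, S (X z) -> z \in s) -> exists n, is_ld S n.
Proof.
move=> d0 Ss.
have bnd k : line_count_ge S k -> (k <= size s)%N.
  move=> [a [v [_ [pts [upts [<- H]]]]]]; apply: uniq_leq_size => // z zp.
  by apply: Ss; case: (H _ zp).
have lc0 : line_count_ge S 0.
  exists 0, (delta_mx 0 (Ordinal d0)); split; last by exists [::].
  apply/eqP => /rowP/(_ (Ordinal d0))/eqP; rewrite !mxE !eqxx.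
  by rewrite oner_eq0.
suff [k [lk mk]] : exists k, line_count_ge S k /\ forall k', line_count_ge S k' -> (k' <= k)%N.
  exists (k%:Z - 1); rewrite /is_ld subrK; split; first by exists k.
  by move=> k' /mk; rewrite lez_nat.
move: bnd; move: (size s) => m; elim: m => [|m IH] bnd; first by exists 0%N.
case: (classic (line_count_ge S m.+1)) => lm; first by exists m.+1.
apply: IH => k lk; have := bnd _ lk; rewrite leq_eqVlt => /orP[/eqP E|//].
by rewrite E in lk.
Qed.

Variable V : seq 'rV[int]_d.
Local Notation P := (polytope (R := R) V).
Local Notation N := (size V).
(** Entries of V may repeat and need not be extreme points. *)
Definition vert (i : 'I_(size V)) : 'rV[int]_d := nth 0 V i.
Local Notation Xv i := (X (vert i)).

(** Grouping weights by entry of V fixes the index set, whatever family [convex_hull] provides. *)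
Lemma polytopeP x : P x <-> exists b : 'I_N -> R,
  [/\ forall i, 0 <= b i, \sum_i b i = 1 & x = \sum_i b i *: Xv i].
Proof.
split=> [[n [p [a [Sp [a0 [a1 ->]]]]]]|[b [b0 b1 ->]]].
  have /fin_all_exists[k kE] i : exists k : 'I_N, p i = Xv k.
    have [v vV ->] := Sp i; have lt_v : (index v V < N)%N by rewrite index_mem.
    by exists (Ordinal lt_v); rewrite /vert nth_index.
  exists (fun j => \sum_(i | k i == j) a i); split.
  - by move=> j; apply: sumr_ge0.
  - by rewrite -a1 [RHS](partition_big k xpredT).
  - rewrite (partition_big k xpredT) //=; apply: eq_bigr => j _.
    by rewrite scaler_suml; apply: eq_bigr => i /eqP<-; rewrite kE.
exists N, (fun i => Xv i), b; split=> // i; exists (vert i) => //.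
exact: mem_nth.
Qed.

Lemma polytope_convex2 : convex2 P.
Proof. exact: convex_hull_convex2. Qed.

Lemma polytope_comb (I : finType) (a : I -> R) (y : I -> 'rV[R]_d) :
  (forall i, 0 <= a i) -> \sum_i a i = 1 -> (forall i, P (y i)) ->
  P (\sum_i a i *: y i).
Proof.
move=> a0 a1 Py.
have /fin_all_exists[b bE] i := proj1 (polytopeP _) (Py i).
apply/polytopeP; exists (fun k => \sum_i a i * b i k); split.
- by move=> k; apply: sumr_ge0 => i _; rewrite mulr_ge0 //; case: (bE i).
- rewrite exchange_big /= -[RHS]a1; apply: eq_bigr => i _.
  by rewrite -mulr_sumr; case: (bE i) => _ -> _; rewrite mulr1.
- under [RHS]eq_bigr do rewrite scaler_suml.
  rewrite exchange_big /=; apply: eq_bigr => i _.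
  case: (bE i) => _ _ ->; rewrite scaler_sumr.
  by apply: eq_bigr => k _; rewrite scalerA.
Qed.

Lemma polytope_mix y (l : R) (b : 'I_N -> R) : P y -> 0 <= l ->
  (forall i, 0 <= b i) -> l + \sum_i b i = 1 ->
  P (l *: y + \sum_i b i *: Xv i).
Proof.
move=> /polytopeP[c [c0 c1 ->]] l0 b0 lb1; apply/polytopeP.
exists (fun i => l * c i + b i); split.
- by move=> i; rewrite addr_ge0 ?mulr_ge0.
- by rewrite big_split /= -mulr_sumr c1 mulr1.
- rewrite scaler_sumr -big_split; apply: eq_bigr => i _.
  by rewrite scalerDl scalerA.
Qed.

Lemma polytope_vert i : P (Xv i).
Proof. by apply: convex_hull_sub; exists (vert i) => //; apply: mem_nth. Qed.

Lemma polytope_bounded : exists B : nat, forall x, P x -> forall i, `|x 0 i| <= B%:R.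
Proof.
exists (\sum_k \sum_i `|vert k 0%R i|)%N => x /polytopeP[b [b0 b1 ->]] i.
rewrite summxE (le_trans (ler_norm_sum _ _ _)) //.
set B := (\sum_k _)%N.
have -> : B%:R = \sum_k b k * B%:R by rewrite -mulr_suml b1 mul1r.
apply: ler_sum => k _; rewrite !mxE normrM ger0_norm // ler_wpM2l // -intr_norm.
rewrite -[B%:R]/(B%:Z%:~R) ler_int -abszE lez_nat /B (bigD1 k) //= (bigD1 i) //=.
by rewrite -addnA leq_addr.
Qed.

Lemma polytope_lattice_finite : exists s : seq 'rV[int]_d, forall z, P (X z) -> z \in s.
Proof.
have [B HB] := polytope_bounded; have [s sP] := int_box B.
exists s => z /HB zB; apply: sP => i; have := zB i.
by rewrite mxE -intr_norm -[B%:R]/(B%:Z%:~R) ler_int.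
Qed.

Lemma interior_hull_sub x : interior_hull P x -> P x.
Proof.
move=> [n [p [a [Sp [a0 [a1 ->]]]]]]; apply: polytope_comb => // i.
by case: (Sp i) => /interior_sub.
Qed.

End Geometry.

(** * Fibres of a lattice projection *)

Lemma pos_lower_bound (R : realFieldType) (I : finType) (f : I -> R) :
  (forall i, 0 < f i) -> exists2 m : R, 0 < m & forall i, m <= f i.
Proof.
move=> f0; pose M := 1 + \sum_i (f i)^-1.
have s0 (Q : pred I) : 0 <= \sum_(i | Q i) (f i)^-1.
  by apply: sumr_ge0 => i _; rewrite invr_ge0 ltW.
have M0 : 0 < M by rewrite ltr_pwDl.
exists M^-1; first by rewrite invr_gt0.
move=> i; rewrite -[f i]invrK lef_pV2 ?posrE ?invr_gt0 //.
rewrite /M (bigD1 i) //= addrCA lerDl addr_ge0 //.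
Qed.

Lemma common_denominator (I : finType) (f : I -> rat) : (forall i, 0 <= f i) ->
  exists (q : nat) (n : I -> nat), (0 < q)%N /\ forall i, f i = (n i)%:R / q%:R.
Proof.
move=> f0; pose D i := `|denq (f i)|%N.
have D0 i : (0 < D i)%N by rewrite absz_gt0 denq_neq0.
exists (\prod_i D i)%N, (fun i => (`|numq (f i)| * \prod_(j | j != i) D j)%N).
split=> [|i]; first exact: prodn_gt0.
rewrite [X in _ / X%:R](bigD1 i) //= !natrM -mulf_div divff ?mulr1; last first.
  by rewrite pnatr_eq0 -lt0n prodn_gt0.
rewrite -[in LHS](divq_num_den (f i)); congr (_ / _).
  by rewrite -[RHS]/(`|numq (f i)|%:Z%:~R) abszE ger0_norm // numq_ge0.
by rewrite -[RHS]/(`|denq (f i)|%:Z%:~R) abszE gtr0_norm // denq_gt0.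
Qed.

(** Replaces compactness: each key carries at most one value, so finitely many keys carry finitely
    many values and the least one is attained. *)
Lemma functional_rel_max (R : realFieldType) (K : eqType) (s : seq K)
    (Q : K -> R -> Prop) :
  (forall k x y, Q k x -> Q k y -> x = y) ->
  (exists k x, k \in s /\ Q k x) ->
  exists k x, [/\ k \in s, Q k x & forall k' x', k' \in s -> Q k' x' -> x <= x'].
Proof.
move=> Qf; elim: s => [[k [x []]]//|a s IH] ex.
case: (classic (exists k x, k \in s /\ Q k x)) => [/IH[k [x [ks Qx minx]]]|nex].
  case: (classic (exists y, Q a y /\ y < x)) => [[y [Qy lt_yx]]|ny].
    exists a, y; split=> //; first exact: mem_head.
    move=> k' x'; rewrite in_cons => /orP[/eqP-> /(Qf _ _ _ Qy)->//|k's Qx'].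
    by apply: le_trans (minx _ _ k's Qx'); apply: ltW.
  exists k, x; split=> //; first by rewrite in_cons ks orbT.
  move=> k' x'; rewrite in_cons => /orP[/eqP-> Qx'|]; last exact: minx.
  by rewrite leNgt; apply/negP => lt_x; apply: ny; exists x'.
have inN k x : k \in a :: s -> Q k x -> k = a.
  by rewrite in_cons => /orP[/eqP//|ks Qx]; case: nex; exists k, x.
case: ex => k [x [ks Qx]]; exists k, x; split=> // k' x' k's Qx'.
have E : k' = k by rewrite (inN _ _ k's Qx') (inN _ _ ks Qx).
by rewrite E in Qx'; rewrite (Qf _ _ _ Qx Qx').
Qed.

Section Fibres.
Variables (R : realFieldType) (d : nat) (V : seq 'rV[int]_d).
Variables (p w : 'rV[int]_d) (u : 'cV[int]_d).
Local Notation X := (@intmx R d).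
Local Notation P := (polytope (R := R) V).
Local Notation N := (size V).
Hypotheses (wu : w *m u = 1%:M) (Pp : P (X p)).

(** Primitivity at work: pairing with u shows that the real factor t is an integer. *)
Lemma intmx_line (z : 'rV[int]_d) (t : R) : X z = t *: X w ->
  z = (z *m u) 0 0 *: w /\ t = ((z *m u) 0 0)%:~R.
Proof.
move=> zE.
have tE : t = ((z *m u) 0 0)%:~R.
  by rewrite -intmx_mul zE -scalemxAl mxE intmx_mul wu !mxE eqxx mulr1.
by split=> //; apply: (@intmx_inj R); rewrite intmxZ -tE.
Qed.

(* [z] lies over an interior point of the projection of the polytope along [w]. *)
Definition fibre_interior (z : 'rV[int]_d) := exists s : R, interior P (X z + s *: X w).

Definition dir (i : 'I_N) : 'rV[R]_d := X (vert i) - X p.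
Definition dcomb (b : 'I_N -> R) : 'rV[R]_d := \sum_i b i *: dir i.

(* Modulo [w], [z] is the convex combination of [p], with coefficient
   [1 - \sum_i b i], and of the points of [V], with coefficients [b]. *)
Definition rep (z : 'rV[int]_d) (b : 'I_N -> R) := [/\ forall i, 0 <= b i,
  \sum_i b i <= 1 & exists s, X z = X p + dcomb b + s *: X w].

Definition supp (b : 'I_N -> R) : {set 'I_N} := [set i | 0 < b i].

(** Linear independence of the [dir i], i in I, modulo w; equivalently, p and these entries of V
    have affinely independent projections along w. *)
Definition indep (I : {set 'I_N}) := forall c a, (forall i, i \notin I -> c i = 0) ->
  dcomb c + a *: X w = 0 -> forall i, c i = 0.

(** Coefficient functions below are written literally as k * b i + m * c i, even with factors 1 or
    0, so that this lemma and [sum_lin] rewrite them without extensionality. *)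
Lemma dcomb_lin (k m : R) b c :
  dcomb (fun i => k * b i + m * c i) = k *: dcomb b + m *: dcomb c.
Proof.
rewrite /dcomb !scaler_sumr -big_split; apply: eq_bigr => i _.
by rewrite scalerDl !scalerA.
Qed.

Lemma sum_lin (k m : R) (b c : 'I_N -> R) :
  \sum_i (k * b i + m * c i) = k * (\sum_i b i) + m * (\sum_i c i).
Proof. by rewrite big_split /= -!mulr_sumr. Qed.

Lemma dcombE b : dcomb b = \sum_i b i *: X (vert i) - (\sum_i b i) *: X p.
Proof.
rewrite scaler_suml -sumrB; apply: eq_bigr => i _.
by rewrite -scalerBr.
Qed.

(** The weight left at p may be moved to any y of P; taking y = p + n w gives the far end of the
    segment over a represented point. *)
Lemma polytope_dcomb y b : P y -> (forall i, 0 <= b i) -> \sum_i b i <= 1 ->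
  P (X p + dcomb b + (1 - \sum_i b i) *: (y - X p)).
Proof.
move=> Py b0 b1.
have -> : X p + dcomb b + (1 - \sum_i b i) *: (y - X p) =
  (1 - \sum_i b i) *: y + \sum_i b i *: X (vert i).
  by rewrite dcombE; apply/rowP => k; rewrite !mxE; ring.
by apply: polytope_mix; rewrite ?subr_ge0 // subrK.
Qed.

Lemma polytope_dcombp b : (forall i, 0 <= b i) -> \sum_i b i <= 1 ->
  P (X p + dcomb b).
Proof.
move=> b0 b1; have := polytope_dcomb Pp b0 b1.
by rewrite subrr scaler0 addr0.
Qed.

Lemma polytope_dcombP y : P y -> exists b,
  [/\ forall i, 0 <= b i, \sum_i b i = 1 & y = X p + dcomb b].
Proof.
move=> /polytopeP[b [b0 b1 yE]]; exists b; split=> //.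
by rewrite dcombE b1 scale1r addrC subrK.
Qed.

(** One can move slightly past an interior point, away from p, and stay in P; contracting back
    towards p leaves positive weight at p. *)
Lemma fibre_rep z : fibre_interior z -> exists2 b, rep z b & \sum_i b i < 1.
Proof.
move=> [s /(interior_shift (X z + s *: X w - X p))[e e0]].
have e1 : 0 < 1 + e by rewrite addr_gt0.
move=> /polytope_dcombP[b [b0 b1 yE]].
exists (fun i => (1 + e)^-1 * b i + 0 * b i); last first.
  by rewrite sum_lin b1 mulr1 mul0r addr0 invf_lt1 // ltrDl.
split.
- by move=> i; rewrite mul0r addr0 mulr_ge0 // invr_ge0 ltW.
- by rewrite sum_lin b1 mulr1 mul0r addr0 invf_le1 // lerDl ltW.
- exists (- s); rewrite dcomb_lin scale0r addr0.
  have -> : dcomb b = X z + s *: X w + e *: (X z + s *: X w - X p) - X p.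
    by rewrite yE addrC addKr.
  by apply/rowP => k; rewrite !mxE; field; rewrite gt_eqF.
Qed.

(** For small m > 0, z' is modulo w the mixture, with weights m and 1 - m, of z and of the point
    with coefficients (b' - m b) / (1 - m). The latter lies in P, so [interior_mix] applies. *)
Lemma rep_spread z b z' b' : fibre_interior z -> rep z b -> rep z' b' ->
  \sum_i b' i < 1 -> (forall i, 0 < b i -> 0 < b' i) -> fibre_interior z'.
Proof.
move=> [s zi] [b0 b1 [r zE]] [b'0 _ [r' z'E]] lt_b' pos.
pose f (o : option 'I_N) := if o is Some i then (if 0 < b i then b' i else 1)
  else 1 - \sum_i b' i.
have [|m0 m0_gt0 m0_le] := @pos_lower_bound R _ f.
  by case=> [i|] /=; [case: ifP => // /pos | rewrite subr_gt0].
have sb'0 : 0 <= \sum_i b' i by apply: sumr_ge0.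
have sb0 : 0 <= \sum_i b i by apply: sumr_ge0.
have m0N := m0_le None; rewrite /= in m0N.
(* m0 is at most 1 - sum b' <= 1; halving makes m < 1. *)
pose m := m0 / 2; have m_gt0 : 0 < m by rewrite divr_gt0.
have m_lt1 : m < 1 by rewrite /m; lra.
have m1 : 0 < 1 - m by rewrite subr_gt0.
have b_le1 i : b i <= 1.
  by rewrite (le_trans _ b1) // (bigD1 i) //= lerDl sumr_ge0.
have mb i : 0 <= b' i - m * b i.
  rewrite subr_ge0; have := b0 i; rewrite le_eqVlt => /orP[/eqP<-|bi].
    by rewrite mulr0.
  have := m0_le (Some i); rewrite /= bi => le_m.
  have : m * b i <= m by rewrite -{2}[m]mulr1 ler_wpM2l // ltW.
  by move=> H; apply: (le_trans H); rewrite /m; lra.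
pose c i := (1 - m)^-1 * b' i + (- (m / (1 - m))) * b i.
have cE i : c i = (b' i - m * b i) / (1 - m).
  by rewrite /c; field; rewrite gt_eqF.
have Pc : P (X p + dcomb c).
  apply: polytope_dcombp => [i|]; first by rewrite cE divr_ge0 // ltW.
  have -> : \sum_i c i = (\sum_i b' i - m * \sum_i b i) / (1 - m).
    by rewrite sum_lin; field; rewrite gt_eqF.
  rewrite ler_pdivrMr // mul1r.
  have : m * (\sum_i b i) >= 0 by rewrite mulr_ge0 // ltW.
  by rewrite /m; lra.
have H := interior_mix (polytope_convex2 (V := V)) m_gt0 (ltW m_lt1) zi Pc.
exists (- r' + m * (r + s)); move: H.
congr (interior _ _); rewrite zE z'E dcomb_lin.
by apply/rowP => k; rewrite !mxE; field; rewrite gt_eqF.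
Qed.

(** Caratheodory's reduction. A dependency c among the supported directions is subtracted until a
    coefficient vanishes; its sign is chosen with sum c >= 0, so that the weight at p does not
    decrease. *)
Lemma rep_improve z b : rep z b -> exists b',
  [/\ rep z b', \sum_i b' i <= \sum_i b i & indep (supp b')].
Proof.
move: {2}#|supp b| (leqnn #|supp b|) => n; elim: n b => [|n IH] b le_n [b0 b1 [s zE]].
  exists b; split=> //; first by split=> //; exists s.
  move: le_n; rewrite leqn0 cards_eq0 => /eqP s0 c a c0 _ i.
  by apply: c0; rewrite s0 inE.
case: (classic (indep (supp b))) => [ind|nind].
  by exists b; split=> //; split=> //; exists s.
have {nind}[c [a [c0 cE [i0 ci0] sc]]] : exists c a,
    [/\ forall i, i \notin supp b -> c i = 0, dcomb c + a *: X w = 0,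
    exists i, 0 < c i & 0 <= \sum_i c i].
  have [c [a [c0 cE [i ci]]]] : exists c a,
    [/\ forall i, i \notin supp b -> c i = 0, dcomb c + a *: X w = 0 &
      exists i, c i != 0].
    apply: NNPP => H; apply: nind => c a c0 cE i; apply/eqP.
    by apply: contra_notT H => ci; exists c, a; split=> //; exists i.
  have key (c' : 'I_N -> R) : (exists i, c' i != 0) -> 0 <= \sum_i c' i -> exists i, 0 < c' i.
    move=> [j cj] sc'; apply: NNPP => H.
    have le0 k : 0 <= - c' k.
      by rewrite oppr_ge0 leNgt; apply/negP => lt; apply: H; exists k.
    have : \sum_i - c' i == 0.
      by rewrite eq_le sumr_ge0 // andbT sumrN oppr_le0.
    rewrite psumr_eq0 // => /allP/(_ j); rewrite mem_index_enum oppr_eq0 => /(_ isT).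
    by rewrite (negPf cj).
  case: (leP 0 (\sum_i c i)) => [sc|/ltW sc].
    by exists c, a; split=> //; apply: key => //; exists i.
  pose c' j := (-1) * c j + 0 * c j.
  have c'E j : c' j = - c j by rewrite /c'; ring.
  have sc' : 0 <= \sum_i c' i by rewrite sum_lin mul0r addr0 mulN1r oppr_ge0.
  exists c', (- a); split=> //.
  - by move=> j /c0 cj; rewrite c'E cj oppr0.
  - by rewrite dcomb_lin scale0r addr0 scaleN1r scaleNr -opprD cE oppr0.
  - by apply: key => //; exists i; rewrite c'E oppr_eq0.
(* The least ratio is the largest t keeping b - t c nonnegative; it kills the coefficient at j. *)
case: (@arg_minP _ _ _ i0 (fun i => 0 < c i) (fun i => b i / c i) ci0) => j cj jmin.
pose t := b j / c j.
have t0 : 0 <= t by rewrite divr_ge0 // ltW.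
pose b' i := 1 * b i + (- t) * c i.
have b'E i : b' i = b i - t * c i by rewrite /b'; ring.
have b'0 i : 0 <= b' i.
  rewrite b'E subr_ge0; case: (ltP 0 (c i)) => ci.
    by have := jmin _ ci; rewrite -/t ler_pdivlMr.
  by rewrite (le_trans _ (b0 i)) // mulr_ge0_le0.
have sb' : \sum_i b' i <= \sum_i b i.
  by rewrite sum_lin mul1r mulNr gerDl oppr_le0 mulr_ge0.
have rb' : rep z b'.
  split=> //; first exact: le_trans b1.
  exists (s - t * a); rewrite dcomb_lin scale1r zE.
  have -> : dcomb c = - (a *: X w) by apply/eqP; rewrite -addr_eq0 cE.
  by apply/rowP => k; rewrite !mxE; ring.
have [|b'' [rb'' sb'' ib'']] := IH b' _ rb'.
  rewrite -ltnS (leq_trans _ le_n) // proper_card //.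
  apply/properP; split.
    apply/subsetP => i; rewrite !inE b'E; apply: contraTT => bi.
    rewrite c0 ?inE // mulr0 subr0 //.
  exists j.
    by rewrite inE; apply: contraLR cj => bj; rewrite c0 ?inE // ltxx.
  by rewrite inE b'E /t divfK ?gt_eqF // subrr ltxx.
by exists b''; split=> //; apply: le_trans sb'.
Qed.

Lemma rep_unique z b b' : indep (supp b) -> supp b' = supp b ->
  rep z b -> rep z b' -> forall i, b i = b' i.
Proof.
move=> ind sE [b0 _ [s zE]] [b'0 _ [s' z'E]] i.
pose c j := 1 * b j + (-1) * b' j.
suff : c i = 0 by rewrite /c mul1r mulN1r => /subr0_eq.
have nsupp a j : (forall i, 0 <= a i) -> j \notin supp a -> a j = 0.
  by move=> a0; rewrite inE -leNgt => aj; apply/eqP; rewrite eq_le aj a0.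
apply: (ind c (s - s')) => [j jb|].
  by rewrite /c !nsupp ?sE // mulr0 mulr0 addr0.
rewrite dcomb_lin scale1r scaleN1r.
have -> : dcomb b = X z - X p - s *: X w by rewrite zE; apply/rowP => k; rewrite !mxE; ring.
have -> : dcomb b' = X z - X p - s' *: X w by rewrite z'E; apply/rowP => k; rewrite !mxE; ring.
by apply/rowP => k; rewrite !mxE; ring.
Qed.

Lemma rep_translate z b (c : int) : rep z b -> rep (z + c *: w) b.
Proof.
move=> [b0 b1 [s zE]]; split=> //; exists (s + c%:~R).
by rewrite intmxD intmxZ zE scalerDl addrA.
Qed.

Lemma fibre_translate z (c : int) : fibre_interior z -> fibre_interior (z + c *: w).
Proof.
move=> [s zi]; exists (s - c%:~R); rewrite intmxD intmxZ scalerBl -addrA.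
by rewrite [_ + (_ - _)]addrC subrK.
Qed.

(** The projection 1 - u w kills w, so it sends z to a translate of z by a multiple of w that
    depends only on the fibre; boundedness of P bounds that translate. *)
Lemma fibre_finite : exists s : seq 'rV[int]_d, forall z, fibre_interior z ->
  exists c : int, z + c *: w \in s.
Proof.
have [B HB] := polytope_bounded R V.
pose M : 'M[int]_d := 1%:M - u *m w.
pose C := (\sum_j \sum_i B * `|M j i|)%N.
have [s sP] := int_box d C; exists s => z [r /interior_sub zP].
exists (- (z *m u) 0 0); apply: sP => i.
have zM : z + (- (z *m u) 0 0) *: w = z *m M.
  rewrite mulmxBr mulmx1 mulmxA; congr (_ + _); rewrite scaleNr; congr (- _).
  by rewrite -mul_scalar_mx -mx11_scalar.
have wM : w *m M = 0 by rewrite mulmxBr mulmx1 mulmxA wu mul1mx subrr.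
have : ((z *m M) 0 i)%:~R = ((X z + r *: X w) *m map_mx intr M) 0 i :> R.
  rewrite mulmxDl -scalemxAl [RHS]mxE [X in _ + X]mxE !intmx_mul wM.
  by rewrite [X in _ * X%:~R]mxE mulr0 addr0.
rewrite zM -(ler_int R) intr_norm => ->.
rewrite mxE (le_trans (ler_norm_sum _ _ _)) //.
rewrite /C -[X in _ <= X]/(_%:R) natr_sum ler_sum // => j _.
rewrite normrM [map_mx _ _ j i]mxE (bigD1 i) //= natrD natrM.
rewrite (le_trans (ler_wpM2r _ (HB _ zP j))) //.
by rewrite -intr_norm -abszE -[X in _ * X <= _]/(_%:R) lerDl ler0n.
Qed.

(** The coefficient at p is 1 - sum b, so it is maximal when sum b is minimal. The competitors b'
    range over all representations, independent or not. *)
Definition optimal z b := [/\ fibre_interior z, rep z b, \sum_i b i < 1,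
  indep (supp b) & forall z' b', fibre_interior z' -> rep z' b' ->
  \sum_i b i <= \sum_i b' i].

(** After translation along w and [rep_improve], a representation is determined by its lattice point
    and its independent support, a key in a finite list. *)
Lemma optimal_exists z : fibre_interior z -> exists z' b, optimal z' b.
Proof.
move=> zi; have [s sP] := fibre_finite.
pose Q (k : 'rV[int]_d * {set 'I_N}) x := fibre_interior k.1 /\
  exists b, [/\ rep k.1 b, supp b = k.2, indep (supp b) & x = \sum_i b i].
pose ks := [seq (a, A) | a <- s, A <- enum {: {set 'I_N}}].
have inQ z' b' : fibre_interior z' -> rep z' b' -> exists k x,
    [/\ k \in ks, Q k x & x <= \sum_i b' i].
  move=> z'i rb'; have [c cs] := sP _ z'i.
  have [b [rb le_b ib]] := rep_improve (rep_translate c rb').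
  exists (z' + c *: w, supp b), (\sum_i b i); split=> //.
    by apply/allpairsP; exists (z' + c *: w, supp b); rewrite cs mem_enum.
  by split; [exact: fibre_translate | exists b].
have [b0 rb0 b0_lt1] := fibre_rep zi.
have [||[z1 I] [x [_ [/= z1i [b [rb _ ib xE]]] minx]]] :=
    @functional_rel_max R _ ks Q.
- move=> [k I] x y [_ [b [/= rb sb ib ->]]] [_ [b' [/= rb' sb' ib' ->]]].
  by apply: eq_bigr => i _; apply: (rep_unique ib _ rb rb'); rewrite sb sb'.
- by have [k [x [kks Qx _]]] := inQ _ _ zi rb0; exists k, x.
have le_x z' b' : fibre_interior z' -> rep z' b' -> x <= \sum_i b' i.
  move=> z'i rb'; have [k [y [kks Qy le_y]]] := inQ _ _ z'i rb'.
  by apply: le_trans le_y; apply: minx kks Qy.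
exists z1, b; split=> //; rewrite -xE //.
exact: le_lt_trans (le_x _ _ zi rb0) b0_lt1.
Qed.

End Fibres.

(** * The Sylvester bound at an optimal point *)

Section OptimalBound.
Variables (R : realFieldType) (d : nat) (V : seq 'rV[int]_d).
Variables (p w : 'rV[int]_d) (u : 'cV[int]_d).
Local Notation X := (@intmx R d).
Local Notation P := (polytope (R := R) V).
Local Notation N := (size V).
Local Notation dir := (@dir R d V p).
Local Notation dcomb := (@dcomb R d V p).
Local Notation rep := (@rep R d V p w).
Local Notation indep := (@indep R d V p w).
Local Notation fibre_interior := (@fibre_interior R d V w).
Local Notation optimal := (@optimal R d V p w).
Hypotheses (wu : w *m u = 1%:M) (Pp : P (X p)).

(** An integer matrix, read over both [R] and [rat] so that solvability can be passed from one to
    the other. *)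
Definition frame (F : fieldType) (A : {set 'I_N}) : 'M[F]_(#|A| + 1, d) :=
  map_mx intr (col_mx (\matrix_(k < #|A|) (vert (enum_val k) - p)) w).

Lemma frame_mul (A : {set 'I_N}) (c : 'rV[R]_#|A|) (a : 'rV[R]_1) :
  row_mx c a *m frame R A = \sum_k c 0 k *: dir (enum_val k) + a 0 0 *: X w.
Proof.
rewrite /frame map_col_mx mul_row_col; congr (_ + _).
  rewrite mulmx_sum_row; apply: eq_bigr => k _; congr (_ *: _).
  rewrite -map_row rowK /dir -intmxB; apply/rowP => j; rewrite !mxE //.
rewrite [a]mx11_scalar mul_scalar_mx mxE eqxx; congr (_ *: _).
Qed.

Lemma frame_free A : indep A -> row_free (frame R A).
Proof.
move=> ind; apply: inj_row_free => v; rewrite -[v]hsubmxK frame_mul.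
set c := lsubmx v; set a := rsubmx v => E.
pose c' (i : 'I_N) := \sum_(k | enum_val k == i) c 0 k.
have c'0 : forall i, c' i = 0.
  apply: (ind c' (a 0 0)) => [i iA|].
    apply: big1 => k /eqP ki; case/negP: iA.
    by rewrite -ki enum_valP.
  rewrite -[RHS]E; congr (_ + _); rewrite [RHS](partition_big (@enum_val _ (mem A)) xpredT) //=.
  apply: eq_bigr => i _; rewrite scaler_suml.
  by apply: eq_bigr => k /eqP->.
have c0 : c = 0.
  apply/rowP => k; rewrite [RHS]mxE -(c'0 (enum_val k)) /c'.
  rewrite (bigD1 k) //= big1 ?addr0 // => j /andP[/eqP/enum_val_inj->].
  by rewrite eqxx.
rewrite c0 in E *.
move: E; rewrite big1 ?add0r => [E|k _]; last by rewrite mxE scale0r.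
have : a 0 0 = 0.
  have [|_] := @intmx_line R d w u wu 0 (a 0 0); first by rewrite intmx0 E.
  by move=> ->; rewrite mul0mx mxE.
move=> a0; rewrite [a]mx11_scalar a0 raddf0 row_mx0 //.
Qed.

Lemma frame_card A : indep A -> (#|A| < d)%N.
Proof.
move=> /frame_free /eqP rk; have := rank_leq_col (frame R A).
by rewrite rk addn1.
Qed.

(** z - p lies in the row space of an integer matrix over R, hence over [rat]; since the rows are
    free, the rational solution is b itself. *)
Lemma rep_rational z b : indep (supp b) -> rep z b ->
  exists (q : nat) (n : 'I_N -> nat), (0 < q)%N /\
  forall i, b i = (n i)%:R / q%:R.
Proof.
move=> ind [b0 _ [s zE]]; pose A := supp b.
have bA i : i \notin A -> b i = 0.
  by rewrite inE -leNgt => bi; apply/eqP; rewrite eq_le bi b0.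
pose c : 'rV[R]_#|A| := \row_k b (enum_val k).
have dE : dcomb b = \sum_k c 0 k *: dir (enum_val k).
  rewrite -[LHS]/(\sum_i b i *: dir i) (bigID (mem A)) /= [X in _ + X]big1 => [|i /bA->].
    by rewrite addr0 big_enum_val; apply: eq_bigr => k _; rewrite mxE.
  by rewrite scale0r.
pose xq : 'rV[rat]_d := map_mx intr (z - p).
have xqE : map_mx (ratr : rat -> R) xq = row_mx c s%:M *m frame R A.
  rewrite frame_mul -dE !mxE eqxx mulr1n.
  have -> : dcomb b + s *: X w = X z - X p.
    by rewrite zE; apply/rowP => j; rewrite !mxE; ring.
  by rewrite -intmxB; apply/rowP => j; rewrite !mxE ratr_int.
have fE : frame R A = map_mx ratr (frame rat A).
  by apply/matrixP => i j; rewrite !mxE ratr_int.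
have /submxP[D DE] : (xq <= frame rat A)%MS.
  by rewrite -(map_submx (ratr : {rmorphism rat -> R})) xqE -fE submxMl.
have cD : row_mx c s%:M = map_mx ratr D.
  apply: (row_free_inj (frame_free ind)).
  by rewrite -xqE DE fE -map_mxM.
have /fin_all_exists[r rE] i : exists r : rat, b i = ratr r.
  case: (boolP (i \in A)) => [iA|/bA->]; last by exists 0; rewrite rmorph0.
  exists (D 0 (lshift 1 (enum_rank_in iA i))).
  have /rowP/(_ (lshift 1 (enum_rank_in iA i))) := cD.
  by rewrite row_mxEl !mxE enum_rankK_in.
have r0 i : 0 <= r i by rewrite -(ler0q R) -rE.
have [q [n [q0 nE]]] := common_denominator r0.
exists q, n; split=> // i.
by rewrite rE nE fmorph_div /= !rmorph_nat.
Qed.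

(* If the inequality fails, pigeonhole yields a multiple [(t + 1) z] that,
   corrected by points of [V], has a larger coefficient at [p]. *)
Lemma optimal_prod_sum z b m (g : 'I_m -> 'I_N) : optimal z b -> injective g ->
  (forall k, 0 < b (g k)) -> \prod_k b (g k) <= 1 - \sum_k b (g k).
Proof.
move=> [zi rb b_lt1 ind minb] ginj bg.
case: m g ginj bg => [|m] g ginj bg; first by rewrite !big_ord0 subr0.
have [q [n [q0 nE]]] := rep_rational ind rb.
have [b0 _ [s zE]] := rb.
have qR : 0 < q%:R :> R by rewrite ltr0n.
have fsum (T : nmodType) (F : 'I_m.+1 -> T) k : \sum_(k' | g k' == g k) F k' = F k.
  by rewrite (big_pred1 k) // => k'; rewrite /= (inj_eq ginj).
have fsum0 (T : nmodType) (F : 'I_m.+1 -> T) i : i \notin codom g ->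
    \sum_(k' | g k' == i) F k' = 0.
  by move=> ig; apply: big1 => k /eqP gk; case/negP: ig; rewrite -gk codom_f.
have sg : \sum_k b (g k) <= \sum_i b i.
  rewrite (partition_big g xpredT) //=; apply: ler_sum => i _.
  case: (boolP (i \in codom g)) => [/codomP[k ->]|ig].
    by rewrite (fsum _ (fun k => b (g k))).
  by rewrite fsum0.
have sn : \sum_k b (g k) = (\sum_k n (g k))%N%:R / q%:R.
  by rewrite natr_sum mulr_suml; apply: eq_bigr.
have lt_q : (\sum_k n (g k) < q)%N.
  have := le_lt_trans sg b_lt1; rewrite sn ltr_pdivrMr // mul1r.
  by rewrite ltr_nat.
rewrite leNgt; apply/negP => big_prod.
have [||| t [c [t0 ct cn]]] :=
    @box_pigeonhole m (fun k => n (g k)) q (q - \sum_k n (g k))%N.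
- by rewrite subnKC // ltnW.
- by rewrite subn_gt0.
(* Clearing denominators by q^(m+1) turns the failed inequality into the hypothesis of the
   pigeonhole lemma with e = q - sum n. *)
- have prodE : \prod_k b (g k) = (\prod_k n (g k))%N%:R / q%:R ^+ m.+1.
    rewrite natr_prod (eq_bigr (fun k => (n (g k))%:R * q%:R^-1)) //.
    by rewrite big_split /= prodr_const card_ord exprVn.
  move: big_prod; rewrite prodE sn ltr_pdivlMr ?exprn_gt0 // exprS mulrA mulrBl.
  rewrite mul1r divfK ?gt_eqF // -natrB ?(ltnW lt_q) // -natrX -natrM ltr_nat.
  by rewrite mulnC.
pose mi i : int := \sum_(k | g k == i) c k.
(* As the c_k sum to t, this is an affine combination, and the coefficient at p becomes (t + 1) (1 -
   sum b), which is strictly larger. *)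
pose z' := (t%:Z + 1) *: z - \sum_k c k *: vert (g k).
pose b' i := (t%:R + 1) * b i + (-1) * (mi i)%:~R.
have tR : 0 < t%:R :> R by rewrite ltr0n.
have pos i : 0 < b i -> 0 < b' i.
  move=> bi; rewrite /b'; case: (boolP (i \in codom g)) => [/codomP[k ik]|ig]; last first.
    by rewrite /mi fsum0 // mulr0 addr0 mulr_gt0 // addr_gt0.
  rewrite ik /mi fsum.
  have : `|b (g k) * t%:R - (c k)%:~R| < b (g k).
    have H : `|(n (g k))%:R * t%:R - q%:R * (c k)%:~R| < (n (g k))%:R :> R.
      by have := cn k; rewrite -(ltr_int R) intr_norm rmorphB /= PoszM !rmorphM.
    have -> : b (g k) * t%:R - (c k)%:~R =
      ((n (g k))%:R * t%:R - q%:R * (c k)%:~R) / q%:R.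
      by rewrite nE; field; rewrite gt_eqF.
    by rewrite normrM normfV (gtr0_norm qR) ltr_pdivrMr // [X in _ < X * _]nE divfK ?gt_eqF.
  by rewrite ltr_norml => /andP[]; lra.
have smi : \sum_i (mi i)%:~R = t%:R :> R.
  rewrite -rmorph_sum /= /mi.
  have -> : \sum_i \sum_(k | g k == i) c k = t%:Z.
    by rewrite -ct [RHS](partition_big g xpredT).
  by [].
have sb' : \sum_i b' i = (t%:R + 1) * \sum_i b i - t%:R.
  by rewrite sum_lin smi mulN1r.
have b'0 i : 0 <= b' i.
  have := b0 i; rewrite le_eqVlt => /orP[/eqP bi|/pos/ltW//].
  rewrite /b' -bi mulr0 add0r /mi fsum0 ?mulr0 //.
  by apply/negP => /codomP[k ik]; have := bg k; rewrite -ik -bi ltxx.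
have sb'1 : \sum_i b' i < 1.
  have : (t%:R + 1) * \sum_i b i < (t%:R + 1) * 1 by rewrite ltr_pM2l // addr_gt0.
  by rewrite sb'; lra.
have dmi : dcomb (fun i => (mi i)%:~R) =
    \sum_k (c k)%:~R *: X (vert (g k)) - t%:R *: X p.
  rewrite dcombE smi; congr (_ - _).
  rewrite [RHS](partition_big g xpredT) //=; apply: eq_bigr => i _.
  rewrite /mi rmorph_sum scaler_suml.
  by apply: eq_bigr => k /eqP->.
have rb' : rep z' b'.
  split=> //; first exact: ltW.
  exists ((t%:R + 1) * s).
  rewrite /z' intmxB intmxZ intmx_sum dcomb_lin dmi zE rmorphD /= -[t%:Z%:~R]/(t%:R).
  rewrite (eq_bigr (fun k => (c k)%:~R *: X (vert (g k)))) => [|k _]; last exact: intmxZ.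
  by apply/rowP => j; rewrite !mxE; ring.
have z'i := rep_spread Pp zi rb rb' sb'1 pos.
have := minb _ _ z'i rb'; rewrite sb'.
have : t%:R * \sum_i b i < t%:R * 1 by rewrite ltr_pM2l.
by lra.
Qed.

(** L is the support sorted by decreasing coefficient; [optimal_prod_sum] on its first l entries
    gives the l-th hypothesis of [sylvester_sum_le]. *)
Lemma optimal_bound z b : optimal z b -> exists L : seq 'I_N,
  [/\ uniq L, supp b =i L, (size L < d)%N,
      \sum_i b i <= \sum_(k < size L) sylv_unit R k &
      \sum_i b i = \sum_(k < size L) sylv_unit R k ->
      forall i0 k, (k < size L)%N -> b (nth i0 L k) = sylv_unit R k].
Proof.
move=> opt; have [_ [b0 _ _] _ ind _] := opt.
pose le_b (i j : 'I_N) := b j <= b i.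
pose L := sort le_b (enum (supp b)).
have uL : uniq L by rewrite sort_uniq enum_uniq.
have Lsupp : supp b =i L by move=> i; rewrite mem_sort mem_enum.
have Lpos i : i \in L -> 0 < b i by rewrite -Lsupp inE.
pose x k := nth 0 [seq b i | i <- L] k.
have xE i0 k : (k < size L)%N -> x k = b (nth i0 L k).
  by move=> lt_k; rewrite /x (nth_map i0).
have sumL : \sum_(k < size L) x k = \sum_i b i.
  have -> : \sum_i b i = \sum_(i <- L) b i.
    rewrite [RHS](perm_big (enum (supp b))) /=; last by rewrite perm_sort.
    rewrite big_enum [LHS](bigID (mem (supp b))) /= [X in _ + X]big1 ?addr0 // => i.
    by rewrite inE -leNgt => bi; apply/eqP; rewrite eq_le bi b0.
  by rewrite -(big_map b xpredT idfun) (big_nth 0) size_map big_mkord.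
have x0 k : (k < size L)%N -> 0 < x k.
  move=> lt_k; have i0 := tnth (in_tuple L) (Ordinal lt_k).
  by rewrite (xE i0) // Lpos // mem_nth.
have [] := @sylvester_sum_le R (size L) x x0.
- move=> i j /andP[le_ij lt_j]; have lt_i := leq_ltn_trans le_ij lt_j.
  have i0 := tnth (in_tuple L) (Ordinal lt_j).
  rewrite (xE i0) // (xE i0) //.
  apply: (@sorted_leq_nth _ le_b) => //.
  + by move=> ? ? ?; rewrite /le_b => H1 H2; apply: le_trans H2 H1.
  + by move=> ?; apply: lexx.
  + by apply: sort_sorted => ? ?; apply: le_total.
- move=> l le_l; pose g (k : 'I_l) := tnth (in_tuple L) (widen_ord le_l k).
  have gE (k : 'I_l) : x k = b (g k).
    by rewrite /g (tnth_nth (g k)) -xE //= (leq_trans (ltn_ord k)).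
  rewrite (eq_bigr (fun k => b (g k))) // [X in 1 - X](eq_bigr (fun k => b (g k))) //.
  apply: (optimal_prod_sum opt) => [k k'|k]; last by apply: Lpos; rewrite mem_tnth.
  rewrite /g => /eqP; rewrite (tnth_nth (g k)) (tnth_nth (g k)) /= nth_uniq //.
  + by move=> /eqP/val_inj.
  + exact: leq_trans (ltn_ord k) le_l.
  + exact: leq_trans (ltn_ord k') le_l.
rewrite sumL => le_s eq_s; exists L; split=> //.
- by rewrite size_sort -cardE frame_card.
- by move=> /eq_s H i0 k lt_k; rewrite -xE // H.
Qed.

End OptimalBound.

(** * Interior lattice points on a fibre *)

Section FibreCount.
Variables (R : realFieldType) (d : nat) (V : seq 'rV[int]_d).
Variables (p w : 'rV[int]_d) (u : 'cV[int]_d) (K n : nat).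
Local Notation X := (@intmx R d).
Local Notation P := (polytope (R := R) V).
Local Notation N := (size V).
Local Notation dcomb := (@dcomb R d V p).
Local Notation optimal := (@optimal R d V p w).
Hypotheses (wu : w *m u = 1%:M) (Pp : P (X p)) (Pn : P (X (p + n%:Z *: w))).
Hypothesis Kmax : forall k, line_count_ge (interior_hull P) k -> (k <= K)%N.

Lemma primitive_neq0 : w != 0.
Proof.
apply/eqP => w0; have /matrixP/(_ 0 0)/eqP := wu.
by rewrite w0 mul0mx !mxE eqxx.
Qed.

(** The line through z along w meets the interior of P, so every point strictly between two points
    of P on it is interior. *)
Lemma fibre_count z (a b : R) (c : int) (M : nat) : fibre_interior R V w z ->
  P (X z + a *: X w) -> P (X z + b *: X w) ->
  (forall j : nat, (j < M)%N -> a < (c + j%:Z)%:~R < b) -> (M <= K)%N.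
Proof.
move=> [s zi] Pa Pb ab; apply: Kmax.
apply: (@progression_line_count _ _ _ (z + c *: w) w) => [|j /ab/andP[aj jb]].
  exact: primitive_neq0.
apply: convex_hull_sub; split; last by exists (z + c *: w + j%:Z *: w).
rewrite -addrA -scalerDl intmxD intmxZ.
move: ((c + j%:Z)%:~R : R) aj jb => t at_ tb.
have mix y r : P (X z + r *: X w) -> (0 < y) -> y <= 1 ->
    interior P (X z + (y * s + (1 - y) * r) *: X w).
  move=> Pr y0 y1; have := interior_mix (polytope_convex2 (V := V)) y0 y1 zi Pr.
  by congr (interior _ _); apply/rowP => k; rewrite !mxE; ring.
case: (ltgtP s t) => [st|ts|<-//].
  have bs : 0 < b - s by rewrite subr_gt0 (lt_trans st).
  have -> : t = (b - t) / (b - s) * s + (1 - (b - t) / (b - s)) * b.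
    by field; rewrite gt_eqF.
  apply: mix => //; first by rewrite divr_gt0 // subr_gt0.
  by rewrite ler_pdivrMr // mul1r lerD2l lerN2 ltW.
have sa : 0 < s - a by rewrite subr_gt0 (lt_trans at_).
have -> : t = (t - a) / (s - a) * s + (1 - (t - a) / (s - a)) * a.
  by field; rewrite gt_eqF.
apply: mix => //; first by rewrite divr_gt0 // subr_gt0.
by rewrite ler_pdivrMr // mul1r lerD2r ltW.
Qed.

Lemma fibre_floor z (a : R) : P (X z + a *: X w) ->
  exists c : int, c%:~R <= a < (c + 1)%:~R.
Proof.
have [B HB] := polytope_bounded R V => /HB Pa.
have [k wk] : exists k, w 0 k != 0.
  apply/existsP; apply: contraNT primitive_neq0 => /existsPn E.
  by apply/eqP/rowP => k; rewrite mxE; apply/eqP; move: (E k); rewrite negbK.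
apply: (@exists_int_floor _ _ (B + `|z 0%R k|)%N).
have wk1 : 1 <= `|(w 0 k)%:~R| :> R.
  by rewrite -intr_norm -[1]/(1%:~R) ler_int; move: wk; move: (w 0 k) => t; lia.
have : `|a| <= `|a * (w 0 k)%:~R| by rewrite normrM ler_peMr.
move=> /le_trans; apply; have := Pa k; rewrite !mxE => Pk.
rewrite natrD; have -> : `|z 0%R k|%N%:R = `|(z 0 k)%:~R| :> R.
  by rewrite -intr_norm -abszE.
have -> : a * (w 0 k)%:~R = ((z 0 k)%:~R + a * (w 0 k)%:~R) - (z 0 k)%:~R by ring.
by apply: (le_trans (ler_normB _ _)); rewrite lerD2r.
Qed.

(** Over z, P contains the segment from - s to - s + l n in units of w. An interval of length at
    least K + 1 has K + 1 consecutive integers in its interior, unless its length is exactly K + 1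
    and its ends are integers. *)
Lemma optimal_fibre z b (s : R) : optimal z b -> X z = X p + dcomb b + s *: X w ->
  (1 - \sum_i b i) * n%:R <= K.+1%:R /\
  ((1 - \sum_i b i) * n%:R = K.+1%:R -> exists c : int, s = c%:~R).
Proof.
move=> [zi [b0 b1 _] _ _ _] zE; set l := 1 - _.
have Pa : P (X z + (- s) *: X w).
  have := polytope_dcombp Pp b0 b1.
  by congr (polytope _ _); rewrite zE; apply/rowP => k; rewrite !mxE; ring.
have Pb : P (X z + (- s + l * n%:R) *: X w).
  have := polytope_dcomb p Pn b0 b1; congr (polytope _ _); rewrite zE intmxD intmxZ.
  by apply/rowP => k; rewrite !mxE /l -[n%:~R]/(n%:R); ring.
have [c /andP[c1 c2]] := fibre_floor Pa.
have key : K.+1%:R <= l * n%:R -> c%:~R < - s \/ K.+1%:R < l * n%:R -> False.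
  move=> le_K lt_K; suff : (K.+1 <= K)%N by rewrite ltnn.
  apply: (@fibre_count z _ _ (c + 1) _ zi Pa Pb) => j lt_j.
  have jK : j%:R + 1 <= K.+1%:R :> R by rewrite natr1 ler_nat.
  have j0 : 0 <= j%:R :> R by rewrite ler0n.
  move: c1 c2; rewrite !rmorphD /= rmorph1 -[j%:~R]/(j%:R).
  move: (c%:~R : R) lt_K => cR lt_K c1 c2; apply/andP; split; first by lra.
  by case: lt_K; lra.
split.
  by rewrite leNgt; apply/negP => lt; apply: key; [exact: ltW|right].
move=> eq_K; exists (- c); move: c1; rewrite le_eqVlt => /orP[/eqP E|lt_c].
  by rewrite rmorphN /= E opprK.
by case: key; [rewrite eq_K | left].
Qed.

End FibreCount.

(** * The extremal simplices *)

Lemma small_scalar (R : realFieldType) (I : finType) (a c : I -> R) :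
  (forall i, 0 < c i) -> exists2 t : R, 0 < t & forall i, t * a i < c i.
Proof.
move=> c0; have [|t t0 tle] := @pos_lower_bound R I (fun i => c i / (1 + `|a i|)).
  by move=> i; rewrite divr_gt0 // ltr_pwDl.
exists t => // i.
have a1 : 0 < 1 + `|a i| by rewrite ltr_pwDl.
apply: (@le_lt_trans _ _ (t * `|a i|)); first by rewrite ler_pM2l // ler_norm.
apply: (@lt_le_trans _ _ (t * (1 + `|a i|))); first by rewrite ltr_pM2l // ltrDr.
by rewrite -ler_pdivlMr.
Qed.

(* Bezout applied to [s k] and the product of the other [s j] extracts the
   [k]-th summand. *)
Lemma coprime_sum_divisible (R : realFieldType) d m (s : 'I_m -> nat)
    (D : 'I_m -> 'rV[int]_d) (y : 'rV[int]_d) :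
  (forall k, (0 < s k)%N) -> (forall j k, j != k -> coprime (s j) (s k)) ->
  intmx R y = \sum_k (s k)%:R^-1 *: intmx R (D k) ->
  forall k, exists W : 'rV[int]_d, D k = (s k)%:Z *: W.
Proof.
move=> s0 cop yE k; pose q := (\prod_(j | j != k) s j)%N.
have cq : coprime (s k) q.
  rewrite /q; elim/big_rec: _ => [|j a jk ca]; first exact: coprimen1.
  by rewrite coprimeMr cop // eq_sym.
have sR j : (s j)%:R != 0 :> R by rewrite pnatr_eq0 -lt0n.
pose Y := q%:Z *: y - \sum_(j | j != k) (q %/ s j)%N%:Z *: D j.
have YE : (s k)%:Z *: Y = q%:Z *: D k.
  apply: (@intmx_inj R); rewrite !intmxZ /Y intmxB intmxZ yE (bigD1 k) //=.
  rewrite (big_morph (@intmx R d) (@intmxD R d) (@intmx0 R d)).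
  have -> : \sum_(j | j != k) intmx R ((q %/ s j)%N%:Z *: D j) =
     q%:Z%:~R *: \sum_(j | j != k) (s j)%:R^-1 *: intmx R (D j).
    rewrite scaler_sumr; apply: eq_bigr => j jk; rewrite intmxZ scalerA; congr (_ *: _).
    change ((q %/ s j)%:R = q%:R * (s j)%:R^-1 :> R).
    have /divnK {2}<- : (s j %| q)%N by rewrite /q (bigD1 j) //= dvdn_mulr.
    by rewrite natrM mulfK.
  rewrite [q%:Z%:~R *: (_ + _)]scalerDr addrK !scalerA; congr (_ *: _).
  change ((s k)%:R * q%:R / (s k)%:R = q%:R :> R).
  by rewrite mulrAC divff // mul1r.
have /coprimezP[[a c] /= ac] : coprimez q%:Z (s k)%:Z.
  by rewrite coprimezE /= coprime_sym.
exists (a *: Y + c *: D k).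
rewrite scalerDr scalerA mulrC -scalerA YE !scalerA -scalerDl [(s k)%:Z * c]mulrC ac.
by rewrite scale1r.
Qed.

(** Here d = m + 1, and [sylv_prod m] is s_d - 1. *)
Definition simplex_height (m K i : nat) : nat :=
  if (i < m)%N then (sylv_prod i).+1 else (K.+1 * sylv_prod m)%N.

Lemma simplex_height_gt0 m K i : (0 < simplex_height m K i)%N.
Proof. by rewrite /simplex_height; case: ifP => // _; rewrite muln_gt0 sylv_prod_gt0. Qed.

Lemma mem_simplex_verts m K v : v \in simplex_verts m.+1 K ->
  v = 0 \/ exists i : 'I_m.+1, v = (simplex_height m K i)%:Z *: delta_mx 0 i.
Proof.
rewrite inE => /orP[/eqP->|/mapP[i _ ->]]; [by left|right; exists i].
by rewrite /simplex_height ltnS; case: ifP.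
Qed.

Lemma simplex_verts_mem m K (i : 'I_m.+1) :
  (simplex_height m K i)%:Z *: delta_mx 0 i \in simplex_verts m.+1 K.
Proof.
rewrite inE; apply/orP; right; apply/mapP; exists i; first by rewrite mem_enum.
by rewrite /simplex_height ltnS; case: ifP.
Qed.

Lemma simplexP (R : realFieldType) m K (y : 'rV[R]_m.+1) :
  polytope (simplex_verts m.+1 K) y <->
  (forall i, 0 <= y 0 i) /\ \sum_i y 0 i / (simplex_height m K i)%:R <= 1.
Proof.
have h0 (i : 'I_m.+1) : 0 < (simplex_height m K i)%:R :> R.
  by rewrite ltr0n simplex_height_gt0.
split=> [[n [q [a [Sq [a0 [a1 ->]]]]]]|[y0 y1]].
  have qE j : (forall i, 0 <= q j 0 i) /\
      \sum_i q j 0 i / (simplex_height m K i)%:R <= 1.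
    have [v /mem_simplex_verts[->|[i ->]] ->] := Sq j.
      by split=> [i|]; rewrite ?intmx0 ?mxE // big1 // => i _; rewrite !mxE mul0r.
    rewrite intmxZ intmx_delta; split=> [k|].
      by rewrite !mxE mulr_ge0 // ?ler0n; case: ifP.
    rewrite (bigD1 i) //= big1 => [|k /negPf ki].
      by rewrite !mxE !eqxx mulr1 addr0 divff ?gt_eqF ?h0.
    by rewrite !mxE ki andbF mulr0 mul0r.
  split=> [i|].
    rewrite summxE; apply: sumr_ge0 => j _; rewrite mxE mulr_ge0 //.
    by case: (qE j).
  apply: (@le_trans _ _ (\sum_j a j)); last by rewrite a1.
  have -> : \sum_i (\sum_j a j *: q j) 0 i / (simplex_height m K i)%:R =
    \sum_j a j * \sum_i q j 0 i / (simplex_height m K i)%:R.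
    under eq_bigr do rewrite summxE mulr_suml.
    rewrite exchange_big /=; apply: eq_bigr => j _; rewrite mulr_sumr.
    by apply: eq_bigr => i _; rewrite mxE mulrA.
  apply: ler_sum => j _; rewrite -[X in _ <= X]mulr1 ler_wpM2l //.
  by case: (qE j).
set t := \sum_i _ in y1.
(* Index 0 stands for the origin and carries the slack 1 - t. *)
exists m.+2, (fun i => if unlift ord0 i is Some j
    then (simplex_height m K j)%:R *: delta_mx 0 j else 0),
  (fun i => if unlift ord0 i is Some j
    then y 0 j / (simplex_height m K j)%:R else 1 - t).
split; [|split; [|split]].
- move=> i; case: unliftP => [j _|_].
    exists ((simplex_height m K j)%:Z *: delta_mx 0 j); first exact: simplex_verts_mem.
    by rewrite intmxZ intmx_delta.
  by exists 0; rewrite ?inE ?eqxx // intmx0.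
- move=> i; case: unliftP => [j _|_]; last by rewrite subr_ge0.
  by rewrite divr_ge0 // ltW.
- rewrite big_ord_recl unlift_none; under eq_bigr do rewrite liftK.
  by rewrite subrK.
- rewrite big_ord_recl unlift_none scaler0 add0r; under eq_bigr do rewrite liftK.
  rewrite {1}[y]row_sum_delta; apply: eq_bigr => j _.
  by rewrite scalerA divfK ?gt_eqF.
Qed.

Section Extremal.
Variables (R : realFieldType) (m : nat) (V : seq 'rV[int]_m.+1).
Variables (p w z : 'rV[int]_m.+1) (u : 'cV[int]_m.+1) (K : nat).
Local Notation X := (@intmx R m.+1).
Local Notation P := (polytope (R := R) V).
Local Notation N := (size V).
Local Notation n := (K.+1 * sylv_prod m)%N.
Local Notation dir := (@dir R m.+1 V p).
Local Notation dcomb := (@dcomb R m.+1 V p).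
Local Notation rep := (@rep R m.+1 V p w).
Local Notation fibre_interior := (@fibre_interior R m.+1 V w).
Local Notation optimal := (@optimal R m.+1 V p w).
Variables (b : 'I_N -> R) (g : 'I_m -> 'I_N).
Hypotheses (wu : w *m u = 1%:M) (Pp : P (X p)) (Pn : P (X (p + n%:Z *: w))).
Hypothesis Kmax : forall k, line_count_ge (interior_hull P) k -> (k <= K)%N.
Hypotheses (opt : optimal z b) (zE : X z = X p + dcomb b) (ginj : injective g).
Hypothesis bg : forall k, b (g k) = sylv_unit R k.
Hypothesis bout : forall i, i \notin codom g -> b i = 0.

Definition ext (c : 'I_m -> R) (i : 'I_N) : R := \sum_(k | g k == i) c k.

Lemma extE c k : ext c (g k) = c k.
Proof. by rewrite /ext (big_pred1 k) // => j; rewrite /= (inj_eq ginj). Qed.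

Lemma ext_out c i : i \notin codom g -> ext c i = 0.
Proof.
by move=> ig; apply: big1 => k /eqP gk; case/negP: ig; rewrite -gk codom_f.
Qed.

Lemma sum_ext c : \sum_i ext c i = \sum_k c k.
Proof. by rewrite [RHS](partition_big g xpredT). Qed.

Lemma dcomb_ext c : dcomb (ext c) = \sum_k c k *: dir (g k).
Proof.
rewrite [RHS](partition_big g xpredT) //=; apply: eq_bigr => i _.
by rewrite scaler_suml; apply: eq_bigr => k /eqP->.
Qed.

Lemma b_ext i : b i = ext (fun k => sylv_unit R k) i.
Proof.
case: (boolP (i \in codom g)) => [/codomP[k ->]|ig]; first by rewrite extE bg.
by rewrite ext_out // bout.
Qed.

Lemma dcomb_eq c c' : (forall i, c i = c' i) -> dcomb c = dcomb c'.
Proof. by move=> E; apply: eq_bigr => i _; rewrite E. Qed.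

Lemma sum_b : \sum_i b i = 1 - (sylv_prod m)%:R^-1.
Proof. by under eq_bigr do rewrite b_ext; rewrite sum_ext sum_sylv_unit. Qed.

Let su_gt0 k : 0 < sylv_unit R k. Proof. exact: sylv_unit_gt0. Qed.

Lemma basis_exists : exists W : 'I_m -> 'rV[int]_m.+1,
  forall k, X (W k) = sylv_unit R k *: dir (g k).
Proof.
have zpE : X (z - p) =
    \sum_(k < m) (sylv_prod k).+1%:R^-1 *: X (vert (g k) - p).
  rewrite intmxB zE addrAC subrr add0r (dcomb_eq b_ext) dcomb_ext.
  by apply: eq_bigr => k _; rewrite intmxB.
have cop (j k : 'I_m) : j != k -> coprime (sylv_prod j).+1 (sylv_prod k).+1.
  by move=> jk; apply: sylv_coprime; rewrite (inj_eq val_inj).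
have /fin_all_exists[W WE] := coprime_sum_divisible (fun=> ltn0Sn _) cop zpE.
exists W => k; rewrite /dir -intmxB WE intmxZ scalerA mulVf ?scale1r //.
by rewrite pnatr_eq0.
Qed.

Variable W : 'I_m -> 'rV[int]_m.+1.
Hypothesis WE : forall k, X (W k) = sylv_unit R k *: dir (g k).

Definition basis_mx : 'M[int]_m.+1 :=
  \matrix_i (if insub (i : nat) is Some k then W k else w).
Local Notation B := (map_mx intr basis_mx : 'M[R]_m.+1).
Local Notation wid k := (widen_ord (leqnSn m) k).

(** Turns a coordinate along W_k into a coefficient of [dir (g k)], which is s_(k+1) W_k. *)
Definition coef (y : 'rV[R]_m.+1) (k : 'I_m) : R := y 0 (wid k) * sylv_unit R k.

Lemma mul_basis y : y *m B = dcomb (ext (coef y)) + y 0 ord_max *: X w.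
Proof.
rewrite mulmx_sum_row big_ord_recr /= dcomb_ext; congr (_ + _ *: _).
  apply: eq_bigr => k _; rewrite /coef -scalerA -WE; congr (_ *: _).
  by apply/rowP => j; rewrite !mxE /= valK.
by apply/rowP => j; rewrite !mxE /= insubF ?ltnn.
Qed.

Lemma basis_unit : B \in unitmx.
Proof.
have [_ _ _ ind _] := opt.
rewrite -row_free_unit; apply: inj_row_free => y; rewrite mul_basis => E.
have ext0 := ind _ _ _ E.
have c0 k : coef y k = 0.
  rewrite -extE; apply: ext0 => i ib; apply: ext_out.
  apply: contra ib => /codomP[j ->]; rewrite inE bg //.
have y0 k : y 0 (wid k) = 0.
  by have /eqP := c0 k; rewrite mulf_eq0 (gt_eqF (su_gt0 k)) orbF => /eqP.
have ym : y 0 ord_max = 0.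
  have [|_ ->] := @intmx_line R _ w u wu 0 (y 0 ord_max); last by rewrite mul0mx mxE.
  rewrite intmx0 -{1}E dcomb_ext big1 ?add0r // => k _.
  by rewrite c0 scale0r.
apply/rowP => i; rewrite [RHS]mxE; case: (ltnP i m) => [lt_i|ge_i].
  by rewrite -(y0 (Ordinal lt_i)); congr (y 0 _); apply: val_inj.
by rewrite -ym; congr (y 0 _); apply: val_inj => /=; have := ltn_ord i; lia.
Qed.

(** By [rep_spread], positive coefficients at all the [g k] put z' over the interior, so it competes
    with z. *)
Lemma optimal_le z' c : (forall k, 0 < c k) -> \sum_k c k < 1 ->
  (exists s, X z' = X p + dcomb (ext c) + s *: X w) ->
  \sum_i b i <= \sum_k c k.
Proof.
have [zi rb b_lt1 _ minb] := opt.
move=> c0 c1 zs; have rc : rep z' (ext c).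
  split; rewrite ?sum_ext ?(ltW c1) // => i.
  by apply: sumr_ge0 => k _; apply/ltW/c0.
rewrite -sum_ext; apply: (minb z') => //.
apply: (rep_spread Pp zi rb rc); first by rewrite sum_ext.
move=> i; case: (boolP (i \in codom g)) => [/codomP[k ->] _|/bout->].
  by rewrite extE.
by rewrite ltxx.
Qed.

(** Subtracting integer multiples of the W_k from x leaves coefficients in (0, 1/s_(k+1)]. Their sum
    is at most sum b, and optimality forbids a smaller one, so each is 1/s_(k+1) and the coordinates
    of x along the W_k are integers. *)
Lemma lattice_coords x : exists y : 'rV[int]_m.+1, X x = X y *m B.
Proof.
(* The coordinates are computed over [rat], where a ceiling exists. *)
pose Bq : 'M[rat]_m.+1 := map_mx intr basis_mx.
pose yq : 'rV[rat]_m.+1 := map_mx intr x *m invmx Bq.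
pose y : 'rV[R]_m.+1 := map_mx ratr yq.
have BqE : map_mx ratr Bq = B by apply/matrixP => i j; rewrite !mxE ratr_int.
have yB : y *m B = X x.
  have Bqu : Bq \in unitmx.
    by rewrite -(map_unitmx (ratr : {rmorphism rat -> R})) BqE basis_unit.
  rewrite -BqE /y -map_mxM /yq mulmxKV //.
  by apply/rowP => j; rewrite !mxE /= ratr_int.
(* Ceiling minus 1, not the floor: the fractional parts must lie in (0, 1] for the c k to be
   positive. *)
pose a k : int := Num.ceil (yq 0 (wid k)) - 1.
have aE k : (a k)%:~R < y 0 (wid k) <= (a k)%:~R + 1.
  have -> : y 0 (wid k) = ratr (yq 0 (wid k)) by rewrite [LHS]mxE.
  have := ceil_itv (yq 0 (wid k)); rewrite -/(a k).
  rewrite -(ltr_rat R) -(ler_rat R) !ratr_int => /andP[-> /=].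
  by rewrite /a -[X in _ <= _ + X]/(1%:~R) -rmorphD /= subrK.
pose c k := (y 0 (wid k) - (a k)%:~R) * sylv_unit R k.
have c0 k : 0 < c k by have /andP[lt_a _] := aE k; rewrite mulr_gt0 // subr_gt0.
have c_le k : c k <= sylv_unit R k.
  rewrite -[X in _ <= X]mul1r ler_pM2r // lerBlDl.
  by case/andP: (aE k).
have sumu : \sum_(k < m) sylv_unit R k = \sum_i b i.
  by rewrite sum_b sum_sylv_unit.
have [_ _ b_lt1 _ _] := opt.
have xE : X (x - \sum_k a k *: W k) = dcomb (ext c) + y 0 ord_max *: X w.
  rewrite intmxB intmx_sum -yB mul_basis !dcomb_ext addrAC; congr (_ + _).
  rewrite -sumrB; apply: eq_bigr => k _.
  by rewrite intmxZ WE scalerA -scalerBl -mulrBl.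
have le_b : \sum_i b i <= \sum_k c k.
  apply: (@optimal_le (p + (x - \sum_k a k *: W k))) => //.
    by apply: le_lt_trans b_lt1; rewrite -sumu ler_sum.
  by exists (y 0 ord_max); rewrite intmxD xE addrA.
have cE k : c k = sylv_unit R k.
  have : \sum_(k < m) (sylv_unit R k - c k) == 0.
    rewrite eq_le sumr_ge0 ?andbT => [|j _]; last by rewrite subr_ge0.
    by rewrite sumrB sumu subr_le0.
  rewrite psumr_eq0 => [|j _]; last by rewrite subr_ge0.
  by move=> /allP/(_ k); rewrite mem_index_enum subr_eq0 => /(_ isT)/eqP.
have yE k : y 0 (wid k) = (a k + 1)%:~R.
  have := cE k; rewrite -[RHS]mul1r => /(mulIf (lt0r_neq0 (su_gt0 k))) H.
  by apply/eqP; rewrite rmorphD /= rmorph1 addrC -subr_eq; apply/eqP.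
have [|_ ymE] := @intmx_line R _ w u wu (x - \sum_k (a k + 1) *: W k) (y 0 ord_max).
  rewrite intmxB intmx_sum -yB mul_basis dcomb_ext addrAC -[RHS]add0r; congr (_ + _).
  rewrite -sumrB big1 // => k _; rewrite intmxZ WE scalerA -yE.
  by rewrite subrr.
exists (\row_i (if insub (i : nat) is Some k then a k + 1 else
   ((x - \sum_k (a k + 1) *: W k) *m u) 0 0)).
rewrite -yB; congr (_ *m _); apply/rowP => i; rewrite [RHS]mxE [X in X%:~R]mxE.
case: insubP => [k _ ki|]; last rewrite -leqNgt => ge_i.
  by rewrite -yE; congr (y 0 _); apply: val_inj.
by rewrite -ymE; congr (y 0 _); apply: val_inj => /=; have := ltn_ord i; lia.
Qed.

(** Weight t is added at vertex i and its expression in the [dir (g k)] is taken away, so the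
    represented point moves only along w. *)
Lemma rep_perturb i (y : 'rV[R]_m.+1) c t : dir i = y *m B ->
  let c' j := 1 * ext c j + t * (1 * (j == i)%:R + (-1) * ext (coef y) j) in
  dcomb c' = dcomb (ext c) + (t * y 0 ord_max) *: X w /\
  \sum_j c' j = \sum_k c k + t * (1 - \sum_k coef y k).
Proof.
move=> yE c'; have delta : dcomb (fun j => (j == i)%:R) = dir i.
  rewrite /dcomb (bigD1 i) //= eqxx scale1r big1 ?addr0 // => j /negPf->.
  by rewrite scale0r.
split.
  rewrite /c' dcomb_lin dcomb_lin delta yE mul_basis.
  by apply/rowP => j; rewrite !mxE; ring.
have sdelta : \sum_(j < N) (j == i)%:R = 1 :> R.
  by rewrite (bigD1 i) //= eqxx big1 ?addr0 // => j /negPf->.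
by rewrite /c' sum_lin sum_lin !sum_ext sdelta; ring.
Qed.

Lemma sum_coef_height (y : 'rV[R]_m.+1) :
  \sum_i y 0 i / (simplex_height m K i)%:R = \sum_k coef y k + y 0 ord_max / n%:R.
Proof.
rewrite big_ord_recr /=; congr (_ + _); last by rewrite /simplex_height ltnn.
by apply: eq_bigr => k _; rewrite /simplex_height /= ltn_ord.
Qed.

(** Each violated facet inequality contradicts extremality after a small perturbation of b towards
    vertex i: phi > 1 lowers sum b, a last coordinate out of range lengthens the fibre over z, and
    y_k < 0 puts z - W_k over the interior. *)
Lemma vert_in_simplex i y : dir i = y *m B -> polytope (simplex_verts m.+1 K) y.
Proof.
move=> yE; have [zi rb b_lt1 _ minb] := opt; have [b0 b1 _] := rb.
set phi := \sum_k coef y k.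
have l0 : 0 < 1 - \sum_j b j by rewrite subr_gt0.
have S0 : 0 < (sylv_prod m)%:R :> R by rewrite ltr0n sylv_prod_gt0.
have n0 : 0 < n%:R :> R by rewrite ltr0n muln_gt0 sylv_prod_gt0.
have ln : (1 - \sum_j b j) * n%:R = K.+1%:R.
  by rewrite sum_b opprB addrC subrK natrM mulrC mulfK ?gt_eqF.
have sumu : \sum_(k < m) sylv_unit R k = \sum_i b i.
  by rewrite sum_b sum_sylv_unit.
pose fa (o : option 'I_m) := if o is Some k then y 0 (wid k) else 1 - phi.
pose fc (o : option 'I_m) : R := if o is Some k then 1 else 1 - \sum_j b j.
(* t is small enough to keep all coefficients at the [g k], and the one at p, positive. *)
have [|t t0 tlt] := @small_scalar R _ fa fc; first by case.
have ty k : t * y 0 (wid k) < 1 := tlt (Some k).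
have tphi : t * (1 - phi) < 1 - \sum_j b j := tlt None.
have tcoef (k : 'I_m) : 0 < sylv_unit R k - t * coef y k.
  by rewrite /coef mulrA -{1}[sylv_unit R k]mul1r -mulrBl mulr_gt0 // subr_gt0.
have [] := rep_perturb (fun k => sylv_unit R k) t yE.
set bt := fun j : 'I_N => _; rewrite -/phi sumu => dbt sbt.
have btE j : bt j = b j - t * ext (coef y) j + t * (j == i)%:R.
  by rewrite /bt b_ext; ring.
have bt0 j : 0 <= bt j.
  rewrite btE addr_ge0 ?mulr_ge0 ?ler0n ?(ltW t0) //.
  case: (boolP (j \in codom g)) => [/codomP[k ->]|jg].
    by rewrite bg extE ltW.
  by rewrite ext_out // mulr0 subr0.
have bt1 : \sum_j bt j <= 1 by rewrite sbt; lra.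
have zbt : X z = X p + dcomb bt + (- (t * y 0 ord_max)) *: X w.
  by rewrite dbt zE (dcomb_eq b_ext) scaleNr addrA addrK.
have rbt : rep z bt by split=> //; exists (- (t * y 0 ord_max)).
have phi1 : phi <= 1.
  rewrite leNgt; apply/negP => phi1; have := minb _ _ zi rbt; rewrite sbt.
  have : t * (1 - phi) < 0 by rewrite pmulr_rlt0 // subr_lt0.
  by lra.
have Pz0 : P (X z + 0 *: X w).
  by rewrite scale0r addr0 zE; apply: polytope_dcombp.
have Pzn : P (X z + K.+1%:R *: X w).
  have := polytope_dcomb p Pn b0 b1; congr (polytope _ _).
  rewrite zE intmxD intmxZ -ln.
  by apply/rowP => j; rewrite !mxE -[n%:~R]/(n%:R); ring.
have Pzt : P (X z + (t * y 0 ord_max) *: X w).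
  have := polytope_dcombp Pp bt0 bt1; congr (polytope _ _).
  by rewrite zbt scaleNr subrK.
have Pztn : P (X z + (K.+1%:R + t * (y 0 ord_max - n%:R * (1 - phi))) *: X w).
  have := polytope_dcomb p Pn bt0 bt1; congr (polytope _ _).
  rewrite zbt intmxD intmxZ sbt -ln.
  by apply/rowP => j; rewrite !mxE -[n%:~R]/(n%:R); ring.
(* Otherwise the fibre over z extends below 0, and 0, ..., K become K + 1 interior lattice points;
   [ymn] treats the other end, with 1, ..., K + 1. *)
have ym0 : 0 <= y 0 ord_max.
  rewrite leNgt; apply/negP => ym; suff : (K.+1 <= K)%N by rewrite ltnn.
  apply: (fibre_count wu Kmax (c := 0) zi Pzt Pzn) => j lt_j.
  rewrite add0r -[j%:~R]/(j%:R) ltr_nat lt_j andbT.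
  by apply: (@lt_le_trans _ _ 0); rewrite ?ler0n // pmulr_rlt0.
have ymn : y 0 ord_max <= n%:R * (1 - phi).
  rewrite leNgt; apply/negP => ym; suff : (K.+1 <= K)%N by rewrite ltnn.
  apply: (fibre_count wu Kmax (c := 1) zi Pz0 Pztn) => j lt_j.
  rewrite -[(1 + j%:Z)%:~R]/(j.+1%:R) ltr0n /=.
  apply: (@le_lt_trans _ _ K.+1%:R); first by rewrite ler_nat.
  by rewrite ltrDl mulr_gt0 // subr_gt0.
(* z - W_k has coefficient 0 at [g k]. If y_k < 0, perturbing makes that coefficient positive, so z
   - W_k lies over the interior, while its unperturbed representation has a sum below sum b. *)
have yk0 k : 0 <= y 0 (wid k).
  rewrite leNgt; apply/negP => yk.
  pose c (j : 'I_m) : R := if j == k then 0 else sylv_unit R j.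
  have sc : \sum_j c j = \sum_j b j - sylv_unit R k.
    rewrite -sumu (bigD1 k) //= [in RHS](bigD1 k) //= /c eqxx add0r [RHS]addrAC subrr add0r.
    by apply: eq_bigr => j /negPf->.
  have zkE : X (z - W k) = X p + dcomb (ext c).
    rewrite intmxB zE (dcomb_eq b_ext) !dcomb_ext (bigD1 k) //= WE.
    have ck : c k = 0 by rewrite /c eqxx.
    rewrite [in RHS](bigD1 k) //= ck scale0r add0r -addrA; congr (_ + _).
    rewrite addrAC subrr add0r; apply: eq_bigr => j /negPf jk.
    by rewrite /c jk.
  have [] := rep_perturb c t yE; set ct := fun j : 'I_N => _.
  rewrite -/phi sc => dct sct.
  have ct0 j : 0 < b j -> 0 < ct j.
    case: (boolP (j \in codom g)) => [/codomP[l ->] _|/bout->]; last by rewrite ltxx.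
    have -> : ct (g l) = c l - t * coef y l + t * (g l == i)%:R.
      by rewrite /ct !extE; ring.
    rewrite ltr_pwDl ?mulr_ge0 ?ler0n ?(ltW t0) // /c.
    case: eqP => [->|_]; last exact: tcoef.
    by rewrite sub0r oppr_gt0 pmulr_rlt0 // /coef pmulr_llt0.
  have ct0' j : 0 <= ct j.
    case: (boolP (j \in codom g)) => [/codomP[l ->]|jg].
      by apply/ltW/ct0; rewrite bg.
    by rewrite /ct !ext_out // !mulr0 addr0 add0r mul1r mulr_ge0 ?ler0n // ltW.
  have ct1 : \sum_j ct j < 1 by have := su_gt0 k; rewrite sct; lra.
  have rct : rep (z - W k) ct.
    split=> //; [exact: ltW|exists (- (t * y 0 ord_max))].
    by rewrite dct zkE scaleNr addrA addrK.
  have zki := rep_spread Pp zi rb rct ct1 ct0.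
  have rc : rep (z - W k) (ext c).
    split; last by exists 0; rewrite scale0r addr0.
      move=> j; apply: sumr_ge0 => l _; rewrite /c; case: eqP => // _.
      exact: ltW.
    by rewrite sum_ext sc; have := su_gt0 k; lra.
  have := minb _ _ zki rc; rewrite sum_ext sc.
  by have := su_gt0 k; lra.
apply/simplexP; split=> [j|].
  case: (ltnP j m) => [lt_j|ge_j].
    by have := yk0 (Ordinal lt_j); congr (0 <= y 0 _); apply: val_inj.
  move: ym0; congr (0 <= y 0 _); apply: val_inj => /=.
  by have := ltn_ord j; lia.
rewrite sum_coef_height -/phi -lerBrDl ler_pdivrMr // mulrC //.
Qed.

(** Coordinates in the lattice basis, with origin p. The vertices of the simplex come from p, the
    [vert (g k)] and p + n w, all in P; the other inclusion is [vert_in_simplex]. *)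
Lemma extremal_simplex : unimod_equiv P (polytope (R := R) (simplex_verts m.+1 K)).
Proof.
have Bu := basis_unit; pose A := invmx B.
have n0 : 0 < n%:R :> R by rewrite ltr0n muln_gt0 sylv_prod_gt0.
exists A, (- X p *m A); split; first by rewrite unitmx_inv.
split; [|split].
- move=> x; have [y yE] := lattice_coords (x - p); exists y.
  by rewrite -mulmxDl -intmxB yE mulmxK.
- move=> y; exists (p + y *m basis_mx).
  rewrite -mulmxDl intmxD addrAC subrr add0r.
  have -> : X (y *m basis_mx) = X y *m B by exact: map_mxM.
  by rewrite mulmxK.
- move=> y; split=> [[k [q [a [Sq [a0 [a1 ->]]]]]]|[x [/polytopeP[c [c0 c1 ->]] <-]]].
    exists (X p + (\sum_i a i *: q i) *m B); split; last first.
      by rewrite -mulmxDl addrAC subrr add0r mulmxK.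
    have -> : X p + (\sum_i a i *: q i) *m B = \sum_i a i *: (X p + q i *m B).
      rewrite mulmx_suml; under [RHS]eq_bigr do rewrite scalerDr.
      rewrite big_split /= -scaler_suml a1 scale1r; congr (_ + _).
      by apply: eq_bigr => i _; rewrite scalemxAl.
    apply: polytope_comb => // i.
    have [v /mem_simplex_verts[->|[j ->]] ->] := Sq i.
      by rewrite intmx0 mul0mx addr0.
    rewrite intmxZ intmx_delta mul_basis.
    case: (ltnP j m) => [lt_j|ge_j].
      have dm (t : R) : (t *: delta_mx 0 j : 'rV[R]_m.+1) 0 ord_max = 0.
        by rewrite !mxE eqxx -(inj_eq val_inj) /= gtn_eqF // mulr0.
      rewrite dm scale0r addr0 dcomb_ext (bigD1 (Ordinal lt_j)) //= big1 => [|l lj].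
        rewrite addr0 /coef !mxE eqxx -(inj_eq val_inj) /= eqxx mulr1.
        rewrite /simplex_height lt_j mulfV ?pnatr_eq0 // scale1r /dir addrC subrK.
        exact: polytope_vert.
      rewrite /coef !mxE eqxx -(inj_eq val_inj) /=.
      by rewrite -(inj_eq val_inj) /= in lj; rewrite (negPf lj) mulr0 mul0r scale0r.
    have jm : j = ord_max by apply: val_inj => /=; have := ltn_ord j; lia.
    rewrite jm dcomb_ext big1 => [|l _].
      rewrite add0r !mxE !eqxx mulr1 /simplex_height ltnn.
      by move: Pn; rewrite intmxD intmxZ.
    by rewrite /coef !mxE eqxx -(inj_eq val_inj) /= ltn_eqF // mulr0 mul0r scale0r.
  have -> : (\sum_i c i *: X (vert i)) *m A + (- X p) *m A =
      \sum_i c i *: (dir i *m A).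
    rewrite -mulmxDl; have -> : \sum_i c i *: X (vert i) - X p = \sum_i c i *: dir i.
      rewrite -[X p]scale1r -c1 scaler_suml -sumrB.
      by apply: eq_bigr => i _; rewrite -scalerBr.
    by rewrite mulmx_suml; apply: eq_bigr => i _; rewrite scalemxAl.
  apply: polytope_comb => // i; apply: vert_in_simplex.
  by rewrite mulmxKV.
Qed.

End Extremal.

(** * The bound for one lattice segment, and the converse *)

Section Bounds.
Variables (R : realFieldType) (m : nat) (V : seq 'rV[int]_m.+1) (K : nat).
Local Notation X := (@intmx R m.+1).
Local Notation P := (polytope (R := R) V).
Local Notation S := (polytope (R := R) (simplex_verts m.+1 K)).
Local Notation wid k := (widen_ord (leqnSn m) k).

(** With r the size of the support and l the coefficient at p, 1/(s_1 ... s_m) <= 1/(s_1 ... s_r) <=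
    l and l n <= K + 1. The extremal n collapses the chain: r = m, b_k = 1/s_k, and the fibre has
    integer ends. *)
Lemma segment_bound (p w z0 : 'rV[int]_m.+1) (u : 'cV[int]_m.+1) (n : nat) :
  (0 < m)%N -> w *m u = 1%:M -> P (X p) -> P (X (p + n%:Z *: w)) ->
  (forall k, line_count_ge (interior_hull P) k -> (k <= K)%N) ->
  fibre_interior R V w z0 ->
  (n <= K.+1 * sylv_prod m)%N /\ (n = (K.+1 * sylv_prod m)%N -> unimod_equiv P S).
Proof.
move=> m0 wu Pp Pn Kmax z0i.
have [z [b opt]] := optimal_exists p wu z0i.
have [L [uL Lb szL le_b eq_b]] := optimal_bound wu Pp opt.
have [zi rb b_lt1 ind minb] := opt; have [b0 b1 [s zE]] := rb.
have [le_K eq_K] := optimal_fibre wu Pp Pn Kmax opt zE.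
have Sm0 : 0 < (sylv_prod m)%:R :> R by rewrite ltr0n sylv_prod_gt0.
have SL0 : 0 < (sylv_prod (size L))%:R :> R by rewrite ltr0n sylv_prod_gt0.
have le_SL : (sylv_prod (size L) <= sylv_prod m)%N.
  move: szL; rewrite ltnS leq_eqVlt => /orP[/eqP->//|/sylv_prod_ltn/ltnW//].
have l_ge : (sylv_prod (size L))%:R^-1 <= 1 - \sum_i b i.
  by move: le_b; rewrite sum_sylv_unit; lra.
have l_ge' : (sylv_prod m)%:R^-1 <= 1 - \sum_i b i.
  by apply: le_trans l_ge; rewrite lef_pV2 ?posrE // ler_nat.
have le_n : (sylv_prod m)%:R^-1 * n%:R <= K.+1%:R :> R.
  by apply: le_trans le_K; rewrite ler_wpM2r ?ler0n.
split.
  by move: le_n; rewrite mulrC ler_pdivrMr // -natrM ler_nat.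
move=> nE; have n0 : 0 < n%:R :> R by rewrite ltr0n nE muln_gt0 sylv_prod_gt0.
have lE : 1 - \sum_i b i = (sylv_prod m)%:R^-1.
  apply/eqP; rewrite eq_le l_ge' andbT -(ler_pM2r n0) (le_trans le_K) //.
  by rewrite nE natrM mulrC mulfK ?gt_eqF.
have rm : size L = m.
  move: l_ge; rewrite lE lef_pV2 ?posrE // ler_nat leqNgt => nlt.
  by move: szL; rewrite ltnS leq_eqVlt => /orP[/eqP//|/sylv_prod_ltn]; rewrite (negPf nlt).
have /eq_b bE : \sum_i b i = \sum_(k < size L) sylv_unit R k.
  by rewrite sum_sylv_unit rm -lE opprB addrC subrK.
have [|c sE] := eq_K; first by rewrite lE nE natrM mulrC mulfK ?gt_eqF.
(* Sliding z along w by the integer offset puts it exactly at p + [dcomb b]. *)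
pose z1 := z + (- c) *: w.
have z1E : X z1 = X p + dcomb p b.
  by rewrite /z1 intmxD intmxZ zE sE rmorphN scaleNr /= addrK.
have opt1 : optimal p w z1 b.
  by split=> //; [exact: fibre_translate | exact: rep_translate].
have L0 : (0 < size L)%N by rewrite rm.
have i0 := tnth (in_tuple L) (Ordinal L0).
pose g (k : 'I_m) := nth i0 L k.
have ginj : injective g.
  by move=> k k' /eqP; rewrite nth_uniq ?rm ?ltn_ord // => /eqP/val_inj.
have bg k : b (g k) = sylv_unit R k by apply: bE; rewrite rm ltn_ord.
have bout i : i \notin codom g -> b i = 0.
  move=> ig; apply/eqP; rewrite eq_le b0 andbT leNgt; apply: contra ig => bi.
  have iL : i \in L by rewrite -Lb inE.
  have lt_i : (index i L < m)%N by move: iL; rewrite -index_mem rm.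
  by apply/codomP; exists (Ordinal lt_i); rewrite /g /= nth_index.
rewrite nE in Pn.
have [W WE] := basis_exists z1E ginj bg bout.
exact: (extremal_simplex wu Pp Pn Kmax opt1 z1E ginj bg bout WE).
Qed.

(** Coordinates equal to 1 already use up 1 - 1/(s_1 ... s_m). Raising one to 2 costs a further
    1/s_(k+1), no less than what is left; so the first m are 1, and the last is below K + 1. *)
Lemma simplex_interior_coords (y : 'rV[int]_m.+1) :
  (forall i, 0 < X y 0 i) ->
  \sum_i X y 0 i / (simplex_height m K i)%:R < 1 ->
  (forall k, X y 0 (wid k) = 1) /\ 1 <= X y 0 ord_max <= K%:R.
Proof.
move=> y0; rewrite sum_coef_height => y1.
have S0 : 0 < (sylv_prod m)%:R :> R by rewrite ltr0n sylv_prod_gt0.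
have n0 : 0 < (K.+1 * sylv_prod m)%N%:R :> R.
  by rewrite ltr0n muln_gt0 sylv_prod_gt0.
have yge i : 1 <= X y 0 i.
  by have := y0 i; rewrite mxE ltr0z -[1]/(1%:~R) ler_int; lia.
have sle (c : 'I_m -> R) : (forall k, c k <= X y 0 (wid k)) ->
    \sum_k c k * sylv_unit R k <= \sum_k coef (X y) k.
  by move=> cy; apply: ler_sum => k _; rewrite ler_wpM2r // ltW ?sylv_unit_gt0.
have sumu := @sum_sylv_unit R m.
have ym : 0 < X y 0 ord_max / (K.+1 * sylv_prod m)%N%:R by rewrite divr_gt0.
have yk k : X y 0 (wid k) = 1.
  apply/eqP; rewrite eq_le yge andbT leNgt; apply/negP => gt1.
  have ge2 : 2 <= X y 0 (wid k).
    by move: gt1; rewrite mxE -[1]/(1%:~R) ltr_int -[2]/(2%:~R) ler_int; lia.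
  have := sle (fun j => 1 + (j == k)%:R).
  have -> : \sum_(j < m) (1 + (j == k)%:R) * sylv_unit R j =
      1 - (sylv_prod m)%:R^-1 + sylv_unit R k.
    under eq_bigr do rewrite mulrDl mul1r.
    rewrite big_split /= sumu; congr (_ + _).
    rewrite (bigD1 k) //= eqxx mul1r big1 ?addr0 // => j /negPf->.
    by rewrite mul0r.
  have : (sylv_prod m)%:R^-1 <= sylv_unit R k.
    by rewrite /sylv_unit lef_pV2 ?posrE ?ltr0n ?sylv_prod_gt0 // ler_nat sylv_prod_ltn.
  move=> le_u /(_ _) H; suff ge1 : 1 <= \sum_k coef (X y) k.
    by have := lt_le_trans y1 ge1; rewrite gtrDl ltNge (ltW ym).
  apply: le_trans (H _); first by lra.
  by move=> j; case: eqP => [->|_]; rewrite ?addr0 ?yge.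
split=> //; rewrite yge /=.
have : \sum_(k < m) 1 * sylv_unit R k <= \sum_k coef (X y) k by apply: sle.
under eq_bigr do rewrite mul1r.
rewrite sumu => le_s.
have : X y 0 ord_max / (K.+1 * sylv_prod m)%N%:R < (sylv_prod m)%:R^-1.
  by move: y1; move: (X y 0 ord_max / _) => t; lra.
rewrite ltr_pdivrMr // natrM mulrC mulfK ?gt_eqF // mxE.
by rewrite -[K.+1%:R]/(K.+1%:Z%:~R) ltr_int -[K%:R]/(K%:Z%:~R) ler_int; lia.
Qed.

(** The edge of the simplex along e_d supplies the long line; all interior lattice points lie on a
    single line, at heights 1, ..., K. *)
Lemma unimod_simplex_counts : unimod_equiv P S ->
  line_count_ge P (K.+1 * sylv_prod m).+1 /\
  (forall k, line_count_ge (interior_hull P) k -> (k <= K)%N).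
Proof.
move=> [A [b [Au [Aint [Asurj PS]]]]].
have h0 (i : 'I_m.+1) : 0 < (simplex_height m K i)%:R :> R.
  by rewrite ltr0n simplex_height_gt0.
have inj x x' : x *m A + b = x' *m A + b -> x = x'.
  by move=> /addIr /(congr1 (mulmx^~ (invmx A))); rewrite !mulmxK.
split.
  have [p pE] := Asurj 0; have [q qE] := Asurj (delta_mx 0 ord_max).
  have E (j : nat) : X (p + j%:Z *: (q - p)) *m A + b = j%:R *: delta_mx 0 ord_max.
    rewrite -intmx_delta -qE -[j%:R *: _]addr0 -[in RHS](intmx0 R m.+1) -pE.
    rewrite intmxD intmxZ intmxB mulmxDl -scalemxAl mulmxBl.
    have pE' : b = - (X p *m A) by apply/eqP; rewrite -addr_eq0 addrC pE intmx0.
    by rewrite pE'; apply/rowP => i; rewrite !mxE -[j%:~R]/(j%:R); ring.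
  apply: (@progression_line_count _ _ _ p (q - p)).
    rewrite subr_eq0; apply/eqP => qp; move: qE; rewrite qp pE => /intmx_inj.
    by move/rowP/(_ ord_max)/eqP; rewrite !mxE !eqxx.
  move=> j; rewrite ltnS => le_j.
  have : S (j%:R *: delta_mx 0 ord_max).
    apply/simplexP; split=> [i|].
      by rewrite !mxE mulr_ge0 ?ler0n.
    rewrite (bigD1 ord_max) //= big1 ?addr0 => [|i /negPf im].
      rewrite !mxE !eqxx mulr1 ler_pdivrMr ?ltr0n ?simplex_height_gt0 // mul1r ler_nat.
      by rewrite /simplex_height ltnn.
    by rewrite !mxE im andbF mulr0 mul0r.
  by move=> /PS[x [Px]]; rewrite -E => /inj<-.
(* A convex condition, so it passes from interior lattice points to their hull. *)
pose good (y : 'rV[R]_m.+1) := (forall k, y 0 (wid k) = 1) /\ 1 <= y 0 ord_max <= K%:R.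
have int_good x : interior P x /\ is_lattice x -> good (x *m A + b).
  move=> [xi [z zE]]; have [y yE] := Aint z.
  rewrite zE yE; rewrite zE in xi.
  have step (e : R) (v : 'rV[R]_m.+1) : P (X z + e *: (v *m invmx A)) -> S (X y + e *: v).
    move=> Pz; apply/PS; eexists; split; first exact: Pz.
    by rewrite mulmxDl -scalemxAl mulmxKV // addrAC yE.
  apply: simplex_interior_coords.
    move=> i; have [e e0 /step/simplexP[/(_ i) yi _]] :=
      interior_shift (- delta_mx 0 i *m invmx A) xi.

    have : X y 0 i + e * (- 1) >= 0.
      by move: yi; rewrite !mxE !eqxx.
    by rewrite mulrN1 subr_ge0; apply: lt_le_trans.
  have [e e0 /step/simplexP[_]] := interior_shift (delta_mx 0 ord_max *m invmx A) xi.
  apply: lt_le_trans.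
  rewrite -subr_gt0 -sumrB (bigD1 ord_max) //= big1 ?addr0 => [|i /negPf im].
    by rewrite !mxE !eqxx mulr1 -mulrBl addrAC subrr add0r divr_gt0 ?ltr0n ?simplex_height_gt0.
  by rewrite !mxE im andbF mulr0 addr0 subrr.
have hull_good x : interior_hull P x -> good (x *m A + b).
  move=> [n [q [a [Sq [a0 [a1 ->]]]]]].
  have -> : (\sum_i a i *: q i) *m A + b = \sum_i a i *: (q i *m A + b).
    under [RHS]eq_bigr do rewrite scalerDr scalemxAl.
    by rewrite big_split /= -scaler_suml a1 scale1r mulmx_suml.
  have qg i := int_good _ (Sq i).
  split=> [k|].
    rewrite summxE -[RHS]a1; apply: eq_bigr => i _.
    by rewrite mxE; case: (qg i) => -> _; rewrite mulr1.
  rewrite summxE; apply/andP; split.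
    rewrite -a1; apply: ler_sum => i _; rewrite mxE -[X in X <= _]mulr1 ler_wpM2l //.
    by case: (qg i) => _ /andP[].
  have -> : K%:R = \sum_i a i * K%:R by rewrite -mulr_suml a1 mul1r.
  apply: ler_sum => i _; rewrite mxE ler_wpM2l //.
  by case: (qg i) => _ /andP[].
move=> k [a [v [_ [pts [upts [<- H]]]]]].
pose f z := (X z *m A + b) 0 ord_max.
have zg z : z \in pts -> good (X z *m A + b) by move=> /H[/hull_good].
have finj : {in pts &, injective f}.
  move=> z z' /zg[g1 _] /zg[g2 _] fE; apply: (@intmx_inj R); apply: inj.
  apply/rowP => i; case: (ltnP i m) => [lt_i|ge_i].
    have -> : i = wid (Ordinal lt_i) by apply: val_inj.
    by rewrite g1 g2.
  have -> : i = ord_max by apply: val_inj => /=; have := ltn_ord i; lia.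
  exact: fE.
have := @uniq_leq_size _ [seq f z | z <- pts] [seq j%:R : R | j <- iota 1 K].
rewrite !size_map size_iota map_inj_in_uniq //; apply=> // _ /mapP[z zp ->].
have [_] := zg _ zp; rewrite /f; have [y ->] := Aint z.
rewrite mxE -[1]/(1%:~R) -[K%:R]/(K%:Z%:~R) !ler_int => /andP[y1 yK].
apply/mapP; exists `|y 0%R ord_max|%N.
  by rewrite mem_iota; move: y1 yK; move: (y 0 ord_max) => t; lia.
by rewrite -[RHS]/(`|y 0%R ord_max|%N%:Z%:~R) abszE ger0_norm // (le_trans _ y1).
Qed.

End Bounds.

Theorem mainTheorem9 (R : realFieldType) (d : nat) (V : seq 'rV[int]_d) :
  (2 <= d)%N ->
  full_dim R V ->
  (exists x, interior_hull (polytope (R:=R) V) x) ->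
  (exists n, is_ld (polytope (R:=R) V) n) /\
  (exists n', is_ld (interior_hull (polytope (R:=R) V)) n') /\
  (forall n n' : int,
     is_ld (polytope (R:=R) V) n ->
     is_ld (interior_hull (polytope (R:=R) V)) n' ->
     n <= (n' + 2) * ((sylvester d)%:Z - 1) /\
     (n = (n' + 2) * ((sylvester d)%:Z - 1) <->
      exists k : nat, unimod_equiv (polytope (R:=R) V) (polytope (R:=R) (simplex_verts d k)))).
Proof.
(* Weights summing to 1 cannot form an empty family, so there is an interior lattice point z0. *)
case: d V => [|m] V // m0 _ [x [[|k] [q [a [Sq [_ [a1 _]]]]]]].
  by move/eqP: a1; rewrite big_ord0 eq_sym oner_eq0.
have [z0i [z0 z0E]] := Sq ord0; rewrite {q Sq a a1}z0E in z0i.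
have [s sP] := polytope_lattice_finite R V.
split; first exact: is_ld_exists sP.
split; first by apply: (@is_ld_exists _ _ _ s) => // z /interior_hull_sub /sP.
move=> n n' [[k1 [lc1 n1]] max1] [[K [lcK n'1]] maxK].
have Kmax j : line_count_ge (interior_hull (polytope (R := R) V)) j -> (j <= K)%N.
  by move=> /maxK; rewrite n'1 lez_nat.
have K0 : (0 < K)%N.
  apply: Kmax; apply: (@progression_line_count _ _ _ z0 (delta_mx 0 ord0)).
    by apply/eqP => /rowP/(_ ord0)/eqP; rewrite !mxE.
  move=> [|//] _; rewrite scale0r addr0; apply: convex_hull_sub; split=> //.
  by exists z0.
have SE : (sylvester m.+1)%:Z - 1 = (sylv_prod m)%:Z.
  by rewrite /sylvester /= -addn1 PoszD addrK.
(* K counts points, so it is ld(P') + 1. *)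
have n'E : n' + 2 = K.+1%:Z by lia.
rewrite SE n'E -PoszM.
have S0 := sylv_prod_gt0 m.
have [le_n eq_n] : n <= (K.+1 * sylv_prod m)%N%:Z /\
   (n = (K.+1 * sylv_prod m)%N%:Z -> exists k,
     unimod_equiv (polytope (R := R) V) (polytope (R := R) (simplex_verts m.+1 k))).
  (* With at most one lattice point per line, n <= 0 is strictly below the positive bound. *)
  case: (leqP k1 1) => [le_k1|gt_k1]; first by split; nia.
  have [p [w [u [wu prog]]]] :=
    line_count_progression (@polytope_convex2 R m.+1 V) gt_k1 lc1.
  have nE : n = k1.-1%:Z by lia.
  have [||||||le_k eq_k] := @segment_bound R m V K p w z0 u k1.-1.
  - by [].
  - exact: wu.
  - by have := prog 0%N; rewrite scale0r addr0; apply; lia.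
  - by apply: prog; lia.
  - exact: Kmax.
  - by exists 0; rewrite scale0r addr0.
  rewrite nE; split; first by rewrite lez_nat.
  by move=> [/eq_k]; exists K.
(* The interior count gives K <= j, and the long edge gives n >= (j + 1) (s_d - 1), so n attains the
   bound. *)
split=> //; split=> // -[j eqv].
have [lcj maxj] := unimod_simplex_counts eqv.
apply/eqP; rewrite eq_le le_n /=.
have := max1 _ lcj; have := maxj _ lcK.
by rewrite -(leq_add2r 1) !addn1 => le_Kj; have := leq_mul le_Kj (leqnn (sylv_prod m)); lia.
Qed.
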